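(* If there is a $2^{o(k\log k)}$ time algorithm for $k\times k$ Permutation Clique, then there is a randomized $2^{o(m)}$ time algorithm for 3SAT with $m$ clauses.
   Context: $[k]\times[k]$ denotes the cells of a $k\times k$ table, $(i,j)$ being the element in row $i$ and column $j$. The $k\times k$ Permutation Clique problem: given a graph $G$ with vertex set $[k]\times[k]$ (parameter $k$), decide whether $G$ contains a clique $\{(1,\rho(1)),\dots,(k,\rho(k))\}$ for some permutation $\rho$ of $[k]$ (i.e. a $k$-clique with exactly one vertex in each row and exactly one vertex in each column). *)

(* Defs.v *)
From HB Require Import structures.
From mathcomp Require Import all_boot all_order all_algebra all_fingroup.
From mathcomp Require Import all_classical all_reals all_analysis.
Import Order.TTheory GRing.Theory Num.Theory numFieldNormedType.Exports.

Set Implicit Arguments.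
Unset Strict Implicit.
Unset Printing Implicit Defensive.

Local Open Scope ring_scope.

(** * Machine model

    Programs are those of the WHILE language on binary trees (N. D. Jones,
    "Computability and Complexity from a Programming Perspective"), extended
    with a coin-flip command.  A command is one step.  Expressions are part of
    the program text, so a step does a bounded number of elementary pointer
    operations; with shared trees, [t] steps on an input of size [n] are
    simulated by a Turing machine in time polynomial in [n + t], and
    conversely.  The classes 2^o(k log k) and 2^o(m) used below are closed
    under such polynomial overheads, for inputs of size polynomial in the
    parameter. *)

Inductive tree : Type := Leaf | Node of tree & tree.

Definition nonleaf (t : tree) : bool := if t is Node _ _ then true else false.

Inductive expr : Type :=
| EVar of nat
| ELeaf
| ENode of expr & expr
| ELeft of expr
| ERight of expr.

Inductive cmd : Type :=
| CAssign of nat & expr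
| CFlip of nat
| CSeq of cmd & cmd
| CIf of expr & cmd & cmd
| CWhile of expr & cmd.

Definition store := nat -> tree.

Definition upd (s : store) (x : nat) (t : tree) : store :=
  fun y => if y == x then t else s y.

Fixpoint eval (s : store) (e : expr) : tree :=
  match e with
  | EVar x => s x
  | ELeaf => Leaf
  | ENode e1 e2 => Node (eval s e1) (eval s e2)
  | ELeft e1 => if eval s e1 is Node l _ then l else Leaf
  | ERight e1 => if eval s e1 is Node _ r then r else Leaf
  end.

Definition enc_bool (b : bool) : tree := if b then Node Leaf Leaf else Leaf.

(** [todo] is the stack of commands still to be executed; [coins] is the
    sequence of outcomes of the coin flips still to come. *)
Record config := Config { todo : seq cmd; memory : store; coins : seq bool }.

Definition step (c : config) : config :=
  let: Config k s r := c in
  match k with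
  | [::] => c
  | CAssign x e :: k' => Config k' (upd s x (eval s e)) r
  | CFlip x :: k' => Config k' (upd s x (enc_bool (head false r))) (behead r)
  | CSeq p q :: k' => Config [:: p, q & k'] s r
  | CIf e p q :: k' => Config ((if nonleaf (eval s e) then p else q) :: k') s r
  | CWhile e p :: k' =>
      Config (if nonleaf (eval s e) then [:: p, CWhile e p & k'] else k') s r
  end.

(** The input is read from, and the answer is left in, variable 0. *)
Definition init (p : cmd) (input : tree) (r : seq bool) : config :=
  Config [:: p] (upd (fun=> Leaf) 0 input) r.

Definition run (p : cmd) (input : tree) (r : seq bool) (t : nat) : config :=
  iter t step (init p input r).

Definition halted (c : config) : bool := nilp (todo c).

Definition accepting (c : config) : bool := nonleaf (memory c 0).

Fixpoint deterministic (p : cmd) : bool :=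
  match p with
  | CAssign _ _ => true
  | CFlip _ => false
  | CSeq p1 p2 | CIf _ p1 p2 => deterministic p1 && deterministic p2
  | CWhile _ p1 => deterministic p1
  end.

(** * Parameterized decision problems and running times *)

Record problem := Problem {
  instance :> Type;
  encode : instance -> tree;
  param : instance -> nat;
  yes : instance -> Prop }.

Definition decides (p : cmd) (A : problem) (T : nat -> nat) : Prop :=
  deterministic p /\
  forall x : A,
    let c := run p (encode x) [::] (T (param x)) in
    halted c /\ (accepting c <-> yes x).

(** Probability of [E] for [n] independent fair coins. *)
Definition coin_prob (n : nat) (E : pred (n.-tuple bool)) : rat :=
  #|[set r | E r]|%:R / #|{: n.-tuple bool}|%:R.

(** Two-sided error at most 1/3, worst-case time over the coin flips.  Since at
    most [t] coins are flipped in [t] steps, the coins are never exhausted. *)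
Definition decides_randomized (p : cmd) (A : problem) (T : nat -> nat) : Prop :=
  forall x : A,
    let t := T (param x) in
    let final (r : t.-tuple bool) := run p (encode x) r t in
    [/\ forall r, halted (final r),
        yes x -> 2 / 3 <= coin_prob (fun r => accepting (final r)) &
        ~ yes x -> 2 / 3 <= coin_prob (fun r => ~~ accepting (final r))].

(** [T] is bounded by 2^o(g). *)
Definition exp2_littleo (R : realType) (g : nat -> R) (T : nat -> nat) : Prop :=
  exists f : nat -> R,
    (f =o_\oo g)%classic /\ forall n, (T n)%:R <= 2 `^ f n.

Definition has_algorithm (R : realType) (A : problem) (g : nat -> R) : Prop :=
  exists (p : cmd) (T : nat -> nat), exp2_littleo g T /\ decides p A T.

Definition has_randomized_algorithm
    (R : realType) (A : problem) (g : nat -> R) : Prop :=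
  exists (p : cmd) (T : nat -> nat),
    exp2_littleo g T /\ decides_randomized p A T.

(** * Encodings *)

Definition enc_seq (X : Type) (enc : X -> tree) (s : seq X) : tree :=
  foldr (fun x t => Node (enc x) t) Leaf s.

(** Unary; this costs only a polynomial factor in the input sizes below. *)
Definition enc_nat (n : nat) : tree := iter n (Node Leaf) Leaf.

Definition enc_table (k : nat) (enc : 'I_k * 'I_k -> tree) : tree :=
  enc_seq (fun i => enc_seq (fun j => enc (i, j)) (enum 'I_k)) (enum 'I_k).

(** * Permutation Clique *)

Record sgraph (V : finType) := SGraph {
  adj :> rel V;
  adj_sym : symmetric adj;
  adj_irr : irreflexive adj }.

Definition is_clique (V : finType) (G : sgraph V) (S : {set V}) : Prop :=
  {in S &, forall u v, u != v -> G u v}.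

Definition has_permutation_clique (k : nat) (G : sgraph ('I_k * 'I_k)%type) :
    Prop :=
  exists rho : 'S_k, is_clique G [set (i, rho i) | i : 'I_k].

(** The adjacency matrix, as a k x k table of k x k tables of bits. *)
Definition enc_table_graph (k : nat) (G : sgraph ('I_k * 'I_k)%type) : tree :=
  enc_table (fun u => enc_table (fun v => enc_bool (G u v))).

Definition permutation_clique : problem :=
  @Problem {k : nat & sgraph ('I_k * 'I_k)%type}
    (fun x => enc_table_graph (tagged x))
    (fun x => tag x)
    (fun x => has_permutation_clique (tagged x)).

(** * 3SAT *)

(** The literal [(v, b)] is true when variable [v] has value [b]. *)
Definition literal := (nat * bool)%type.

(** [m] clauses mention at most [3 * m] variables, which are taken among
    [0, ..., 3 * m - 1], so that the input size is polynomial in [m]. *)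
Record cnf3 := Cnf3 {
  clauses : seq (seq literal);
  cnf3_width : all (fun c => (size c <= 3)%N) clauses;
  cnf3_vars : all (all (fun l => (l.1 < 3 * size clauses)%N)) clauses }.

Definition satisfiable (F : cnf3) : Prop :=
  exists a : nat -> bool, all (has (fun l => a l.1 == l.2)) (clauses F).

Definition enc_literal (l : literal) : tree :=
  Node (enc_nat l.1) (enc_bool l.2).

Definition three_sat : problem :=
  @Problem cnf3
    (fun F => enc_seq (enc_seq enc_literal) (clauses F))
    (fun F => size (clauses F))
    satisfiable.

(* Main.v *)
From mathcomp Require Import all_boot all_order all_algebra all_fingroup.
From mathcomp Require Import all_classical all_reals all_analysis.
From mathcomp Require Import zify.
Require Import Defs.
Import Order.TTheory GRing.Theory Num.Theory numFieldNormedType.Exports.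

(** Choose one literal in every clause: the formula is satisfiable iff some choice
    contains no two contradictory literals.  Put the [m] clauses into groups of
    [h] clauses, with [9 ^ h] of order [m], so that the choices for a group are
    the [3 ^ h = O(sqrt m)] words of length [h] over [{0, 1, 2}].  With one row
    per group and the words as columns, a good choice is a clique with one vertex
    in each of the [k = O(m / log m)] rows, but several of its vertices may share
    a column.  The random permutations of the cells used in the paper to separate
    them can be replaced by an exhaustive search: there are at most
    [2 ^ (3 ^ h + k) = 2 ^ o(m)] multisets of [k] words, and a clique that uses
    the words of a given multiset is exactly a permutation clique of the k x k
    table whose columns are labelled by that multiset.  Since [k log k = O(m)], each
    of these tables is decided in time 2^o(m).  No coin is ever flipped. *)

Set Implicit Arguments.
Unset Strict Implicit.
Unset Printing Implicit Defensive.

Local Open Scope nat_scope.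

(** * Big-step semantics *)

(** Guessing which word goes to which row would take [(3 ^ h) ^ k >= 3 ^ m] trials. The target
    problem already searches over orders through its permutation, so only the multiset has to be
    guessed. Any fixed base above 3 in place of 9 would keep [h] of order [log m] and the number of
    words [o(m)]; with 9 the word count is a square root, which is easy to estimate. The bound [T]
    need not be computable: the solver calls the given decider and waits for it to halt, so [T]
    enters the time analysis only. Since the little-o hypothesis controls [T k] for large [k] only,
    [k] must also tend to infinity with [m]. The solver has to be an explicit program: its
    polynomial parts come from closure properties of polynomial time, while the exponential search
    is a hand-written loop over a stack. *)

Inductive exec : cmd -> store -> store -> nat -> Prop :=
| ExecAssign x e s : exec (CAssign x e) s (upd s x (eval s e)) 1
| ExecSeq p q s1 s2 s3 t1 t2 :
    exec p s1 s2 t1 -> exec q s2 s3 t2 -> exec (CSeq p q) s1 s3 (t1 + t2).+1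
| ExecIf e p q s1 s2 t :
    exec (if nonleaf (eval s1 e) then p else q) s1 s2 t ->
    exec (CIf e p q) s1 s2 t.+1
| ExecWhileF e p s : ~~ nonleaf (eval s e) -> exec (CWhile e p) s s 1
| ExecWhileT e p s1 s2 s3 t1 t2 :
    nonleaf (eval s1 e) -> exec p s1 s2 t1 -> exec (CWhile e p) s2 s3 t2 ->
    exec (CWhile e p) s1 s3 (t1 + t2).+1.

(** No rule of [exec] flips a coin, so [r] passes through unchanged. The arbitrary continuation [k]
    is what makes the induction hypotheses usable inside sequences and loops. *)
Lemma exec_iter p s1 s2 t : exec p s1 s2 t ->
  forall k r, iter t step (Config (p :: k) s1 r) = Config k s2 r.
Proof.
elim=> {p s1 s2 t} /=.
- by [].
- move=> p q s1 s2 s3 t1 t2 _ IH1 _ IH2 k r.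
  by rewrite -iterS iterSr addnC iterD /= IH1 IH2.
- by move=> e p q s1 s2 t _ IH k r; rewrite -iterS iterSr /= IH.
- by move=> e p s /negbTE He k r; rewrite He.
- move=> e p s1 s2 s3 t1 t2 He _ IH1 _ IH2 k r.
  by rewrite -iterS iterSr addnC iterD /= He IH1 IH2.
Qed.

Lemma exec_iter_halted p s1 s2 t T r : exec p s1 s2 t -> t <= T ->
  iter T step (Config [:: p] s1 r) = Config [::] s2 r.
Proof.
move=> /exec_iter E tT; rewrite -(subnK tT) iterD E.
by elim: (T - t) => //= n ->.
Qed.

(** The given decider is known only through [step]; this recovers a big-step derivation from its
    halting. The induction is on time, because a loop re-enters the same command with less time
    left. *)
Lemma halted_exec T : forall p k s r, deterministic p ->
  halted (iter T step (Config (p :: k) s r)) ->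
  exists2 t, t <= T & exists2 s', exec p s s' t &
    iter t step (Config (p :: k) s r) = Config k s' r.
Proof.
elim/ltn_ind: T => -[|T] IH p k s r //.
(* After [q] has finished, the remaining steps are a halting run of the rest of the stack, to which
   the induction hypothesis applies. *)
have E q k' s0 (a b : nat) s1 : a <= b -> exec q s0 s1 a ->
    halted (iter b step (Config (q :: k') s0 r)) ->
    halted (iter (b - a) step (Config k' s1 r)).
  by move=> ab X; rewrite -{1}(subnK ab) iterD (exec_iter X).
suff H : deterministic p -> halted (iter T.+1 step (Config (p :: k) s r)) ->
    exists2 t, t <= T.+1 & exists s', exec p s s' t.
  move=> D Hh; have [t tT [s' X]] := H D Hh.
  by exists t => //; exists s' => //; apply: exec_iter.
rewrite iterSr; case: p => [x e|x|p q|e p q|e p] //=.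
- by exists 1 => //; eexists; constructor.
- case/andP=> Dp Dq Hh.
  have [t1 t1T [s1 X1 _]] := IH T (ltnSn _) _ _ _ _ Dp Hh.
  have H2 := E _ _ _ _ _ _ t1T X1 Hh.
  have [|t2 t2T [s2 X2 _]] := IH (T - t1) _ _ _ _ _ Dq H2; first by rewrite ltnS leq_subr.
  by exists (t1 + t2).+1; [lia | exists s2; econstructor; eassumption].
- case/andP=> Dp Dq Hh.
  have D : deterministic (if nonleaf (eval s e) then p else q) by case: ifP.
  have [t tT [s1 X _]] := IH T (ltnSn _) _ _ _ _ D Hh.
  by exists t.+1 => //; exists s1; constructor.
- move=> Dp; case He : (nonleaf (eval s e)) => Hh; last first.
    by exists 1 => //; exists s; constructor; rewrite He.
  have [t1 t1T [s1 X1 _]] := IH T (ltnSn _) _ _ _ _ Dp Hh.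
  have H2 := E _ _ _ _ _ _ t1T X1 Hh.
  have [|t2 t2T [s2 X2 _]] := IH (T - t1) _ (CWhile e p) _ _ _ Dp H2.
    by rewrite ltnS leq_subr.
  by exists (t1 + t2).+1; [lia | exists s2; econstructor; eassumption].
Qed.

(** * Relocation of programs *)

(** A shifted program touches variables from [d] on only, so a caller can keep its own data below
    [d]. *)
Fixpoint expr_shift d (e : expr) : expr :=
  match e with
  | EVar x => EVar (d + x)
  | ELeaf => ELeaf
  | ENode e1 e2 => ENode (expr_shift d e1) (expr_shift d e2)
  | ELeft e1 => ELeft (expr_shift d e1)
  | ERight e1 => ERight (expr_shift d e1)
  end.

Fixpoint cmd_shift d (p : cmd) : cmd :=
  match p with
  | CAssign x e => CAssign (d + x) (expr_shift d e)
  | CFlip x => CFlip (d + x)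
  | CSeq p q => CSeq (cmd_shift d p) (cmd_shift d q)
  | CIf e p q => CIf (expr_shift d e) (cmd_shift d p) (cmd_shift d q)
  | CWhile e p => CWhile (expr_shift d e) (cmd_shift d p)
  end.

Fixpoint expr_vars (e : expr) : nat :=
  match e with
  | EVar x => x.+1
  | ELeaf => 0
  | ENode e1 e2 => maxn (expr_vars e1) (expr_vars e2)
  | ELeft e1 | ERight e1 => expr_vars e1
  end.

Fixpoint cmd_vars (p : cmd) : nat :=
  match p with
  | CAssign x e => maxn x.+1 (expr_vars e)
  | CFlip x => x.+1
  | CSeq p q => maxn (cmd_vars p) (cmd_vars q)
  | CIf e p q => maxn (expr_vars e) (maxn (cmd_vars p) (cmd_vars q))
  | CWhile e p => maxn (expr_vars e) (cmd_vars p)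
  end.

Lemma deterministic_shift d p : deterministic (cmd_shift d p) = deterministic p.
Proof. by elim: p => //= [p -> q ->|e p -> q ->]. Qed.

(** Agreement is limited to [N] variables because only finitely many can be cleared before a
    call. *)
Definition agree N d (s S : store) := forall i, i < N -> S (d + i) = s i.

Lemma eval_shift N d s S e : agree N d s S -> expr_vars e <= N ->
  eval S (expr_shift d e) = eval s e.
Proof.
move=> A; elim: e => [x||e1 IH1 e2 IH2|e IH|e IH] //=; try by move=> /IH ->.
  exact: A.
by rewrite geq_max => /andP[/IH1 -> /IH2 ->].
Qed.

Lemma exec_shift N d p s s' t S : exec p s s' t -> cmd_vars p <= N ->
  agree N d s S ->
  exists2 S', exec (cmd_shift d p) S S' t &
    agree N d s' S' /\ forall j, j < d -> S' j = S j.
Proof.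
move=> X; elim: X S => {p s s' t} /=.
- move=> x e s S; rewrite geq_max => /andP[xN eN] A.
  eexists; first by constructor.
  rewrite (eval_shift A eN); split=> [i iN|j jd]; rewrite /upd.
    by rewrite eqn_add2l; case: ifP => // _; apply: A.
  by case: eqP => // ?; lia.
- move=> p q s1 s2 s3 t1 t2 _ IH1 _ IH2 S; rewrite geq_max => /andP[pN qN] A.
  have [S1 X1 [A1 F1]] := IH1 _ pN A; have [S2 X2 [A2 F2]] := IH2 _ qN A1.
  exists S2; first by econstructor; eassumption.
  by split=> // j jd; rewrite F2 // F1.
- move=> e p q s1 s2 t _ IH S; rewrite !geq_max => /and3P[eN pN qN] A.
  have [|S1 X1 [A1 F1]] := IH S _ A; first by case: ifP.
  exists S1 => //; constructor; rewrite (eval_shift A eN).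
  by case: ifP X1.
- move=> e p s He S; rewrite geq_max => /andP[eN pN] A.
  by exists S => //; constructor; rewrite (eval_shift A eN).
- move=> e p s1 s2 s3 t1 t2 He _ IH1 _ IH2 S epN A.
  move: (epN); rewrite geq_max => /andP[eN pN].
  have [S1 X1 [A1 F1]] := IH1 _ pN A; have [S2 X2 [A2 F2]] := IH2 _ epN A1.
  exists S2; first by econstructor; rewrite ?(eval_shift A eN) //; eassumption.
  by split=> // j jd; rewrite F2 // F1.
Qed.

(** * Timed postconditions *)

(** Total correctness with a time bound, in weakest-precondition style: the postcondition of one
    command may be the [runs] statement of the next, so intermediate assertions need no name. *)
Definition runs p s T (Q : store -> Prop) :=
  exists s' t, [/\ exec p s s' t, t <= T & Q s'].

Lemma runs_le p s T T' (Q Q' : store -> Prop) :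
  runs p s T Q -> T <= T' -> (forall s', Q s' -> Q' s') -> runs p s T' Q'.
Proof.
move=> [s' [t [X tT q]]] TT QQ; exists s', t; split=> //; last exact: QQ.
exact: leq_trans TT.
Qed.

Lemma runs_leT p s T T' Q : runs p s T Q -> T <= T' -> runs p s T' Q.
Proof. by move=> H TT; apply: runs_le H TT _. Qed.

Lemma runs_assign x e s (Q : store -> Prop) :
  Q (upd s x (eval s e)) -> runs (CAssign x e) s 1 Q.
Proof. by move=> q; do 2 eexists; split; [constructor| |]. Qed.

Lemma runs_seq p q s T1 T2 Q :
  runs p s T1 (fun s1 => runs q s1 T2 Q) -> runs (CSeq p q) s (T1 + T2).+1 Q.
Proof.
move=> [s1 [t1 [X1 t1T [s2 [t2 [X2 t2T q2]]]]]].
exists s2, (t1 + t2).+1; split=> //; first by econstructor; eassumption.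
by rewrite ltnS leq_add.
Qed.

Lemma runs_if e p q s T Q :
  runs (if nonleaf (eval s e) then p else q) s T Q -> runs (CIf e p q) s T.+1 Q.
Proof. by move=> [s' [t [X tT q']]]; exists s', t.+1; split=> //; constructor. Qed.

Lemma runs_whileF e p s (Q : store -> Prop) :
  ~~ nonleaf (eval s e) -> Q s -> runs (CWhile e p) s 1 Q.
Proof. by move=> He q; exists s, 1; split=> //; constructor. Qed.

Lemma runs_whileT e p s T1 T2 Q : nonleaf (eval s e) ->
  runs p s T1 (fun s1 => runs (CWhile e p) s1 T2 Q) ->
  runs (CWhile e p) s (T1 + T2).+1 Q.
Proof.
move=> He [s1 [t1 [X1 t1T [s2 [t2 [X2 t2T q2]]]]]].
exists s2, (t1 + t2).+1; split=> //; first by econstructor; eassumption.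
by rewrite ltnS leq_add.
Qed.

(** * Polynomial-time functions *)

(** On lists of clauses, [code] is convertible with the encoding used by [three_sat]. *)
Class coded (X : Type) := code : X -> tree.

#[global] Instance coded_bool : coded bool := enc_bool.
#[global] Instance coded_nat : coded nat := enc_nat.
#[global] Instance coded_pair X Y (cX : coded X) (cY : coded Y) :
  coded (X * Y) := fun z => Node (code z.1) (code z.2).
#[global] Instance coded_seq X (cX : coded X) : coded (seq X) := enc_seq code.

Fixpoint tsize (t : tree) : nat :=
  if t is Node l r then (tsize l + tsize r).+1 else 1.

Definition sz X (cX : coded X) (x : X) : nat := tsize (code x).
Arguments sz {X cX} x.

Lemma sz_pair X Y (cX : coded X) (cY : coded Y) (x : X) (y : Y) :
  sz (x, y) = (sz x + sz y).+1.
Proof. by []. Qed.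

Lemma sz_nil X (cX : coded X) : sz ([::] : seq X) = 1.
Proof. by []. Qed.

Lemma sz_cons X (cX : coded X) (x : X) s : sz (x :: s) = (sz x + sz s).+1.
Proof. by []. Qed.

Lemma sz_nat n : sz n = n.*2.+1.
Proof. by elim: n => //= n IH; rewrite /sz /= -/(sz n) IH. Qed.

Lemma sz_bool (b : bool) : sz b <= 3.
Proof. by case: b. Qed.

Lemma size_sz X (cX : coded X) (s : seq X) : size s < sz s.
Proof. by elim: s => //= x s IH; rewrite sz_cons; lia. Qed.

Lemma sz_mem (X : eqType) (cX : coded X) (s : seq X) x : x \in s -> sz x <= sz s.
Proof.
elim: s => //= y s IH; rewrite inE sz_cons => /predU1P[->|/IH]; lia.
Qed.

Lemma sz_nth X (cX : coded X) (s : seq X) x0 n : n < size s -> sz (nth x0 s n) <= sz s.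
Proof.
elim: s n => //= y s IH [|n] /=; rewrite sz_cons; first by lia.
by rewrite ltnS => /IH; lia.
Qed.

Lemma sz_seq_le X (cX : coded X) (s : seq X) B :
  (forall x0 n, n < size s -> sz (nth x0 s n) <= B) -> sz s <= size s * B.+1 + 1.
Proof.
elim: s => //= y s IH H; rewrite sz_cons.
have := H y 0 isT; have /IH : forall x0 n, n < size s -> sz (nth x0 s n) <= B.
  by move=> x0 n ns; apply: (H x0 n.+1).
by rewrite /= mulSn; lia.
Qed.

Lemma sz_cat X (cX : coded X) (s1 s2 : seq X) : sz (s1 ++ s2) < sz s1 + sz s2.
Proof. by elim: s1 => [|x s IH] //=; rewrite !sz_cons; lia. Qed.

Lemma leq_expl m n d : m <= n -> m ^ d <= n ^ d.
Proof. by case: d => // d; rewrite leq_exp2r. Qed.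

(** A bound by a fixed power of the size plus 2; the base is at least 2, which
    makes such bounds closed under sums and products. *)
Definition polybounded X (cX : coded X) (g : X -> nat) :=
  exists d, forall x, g x <= (sz x).+2 ^ d.
Arguments polybounded {X cX} g.

Section PolynomialBounds.
Context {X : Type} {cX : coded X}.
Implicit Types g h : X -> nat.

Lemma pb_le g h : polybounded h -> (forall x, g x <= h x) -> polybounded g.
Proof. by move=> [d H] gh; exists d => x; apply: leq_trans (H x). Qed.

Lemma pb_const c : polybounded (fun=> c).
Proof.
exists c => x; apply: leq_trans (ltnW (ltn_expl c (ltnSn 1))) _.
by case: c => // c; rewrite leq_exp2r.
Qed.

Lemma pb_add g h : polybounded g -> polybounded h -> polybounded (fun x => g x + h x).
Proof.
move=> [d1 H1] [d2 H2]; exists (d1 + d2).+1 => x.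
rewrite expnS; apply: leq_trans (leq_mul (_ : 2 <= _) (leqnn _)); last by [].
rewrite mul2n -addnn leq_add //.
  by apply: leq_trans (H1 x) _; rewrite leq_exp2l // leq_addr.
by apply: leq_trans (H2 x) _; rewrite leq_exp2l // leq_addl.
Qed.

Lemma pb_mul g h : polybounded g -> polybounded h -> polybounded (fun x => g x * h x).
Proof.
move=> [d1 H1] [d2 H2]; exists (d1 + d2) => x.
by rewrite expnD leq_mul.
Qed.

Lemma pb_exp g n : polybounded g -> polybounded (fun x => g x ^ n).
Proof.
move=> Hg; elim: n => [|n IH]; first exact: (pb_const 1).
by apply: pb_le (pb_mul Hg IH) _ => x; rewrite expnS.
Qed.

Lemma pb_sz : polybounded (@sz X cX).
Proof. by exists 1 => x; rewrite expn1; lia. Qed.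

End PolynomialBounds.

Lemma pb_comp X Y (cX : coded X) (cY : coded Y) (f : X -> Y) (g : Y -> nat) :
  polybounded g -> polybounded (fun x => sz (f x)) -> polybounded (fun x => g (f x)).
Proof.
move=> [d H] Hf; apply: (pb_le (h := fun x => (sz (f x) + 2) ^ d)).
  by apply: pb_exp; apply: pb_add => //; apply: pb_const.
by move=> x; rewrite addn2.
Qed.

(** Nothing is assumed of the store beyond variable 0, so such programs compose with no clearing in
    between. *)
Definition computes X Y (cX : coded X) (cY : coded Y) c (f : X -> Y) tau :=
  deterministic c /\
  forall x s, s 0 = code x -> runs c s (tau x) (fun s' => s' 0 = code (f x)).

(** The output bound does not follow from the time bound: [t] assignments that each double a tree
    yield a result of size about [2 ^ t]. *)
Definition polytime X Y (cX : coded X) (cY : coded Y) (f : X -> Y) :=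
  (exists c tau, computes cX cY c f tau /\ polybounded tau) /\ polybounded (fun x => sz (f x)).
Arguments polytime {X Y cX cY} f.

Lemma runs_call X Y (cX : coded X) (cY : coded Y) c (f : X -> Y) tau d S x :
  computes cX cY c f tau -> S d = code x ->
  runs (cmd_shift d c) S (tau x)
    (fun S' => S' d = code (f x) /\ forall j, j < d -> S' j = S j).
Proof.
move=> [_ H] Sd; set s := fun i => S (d + i).
have [|s' [t [X1 tT q]]] := H x s; first by rewrite /s addn0.
have [|S' X' [A F]] := @exec_shift (cmd_vars c).+1 d _ _ _ _ S X1 (ltnW (ltnSn _)).
  by move=> i _.
exists S', t; split=> //; split=> //.
by rewrite -(addn0 d) A.
Qed.

Lemma pt_ext X Y (cX : coded X) (cY : coded Y) (f g : X -> Y) :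
  polytime f -> f =1 g -> polytime g.
Proof.
move=> [[c [tau [[D H] B]]] S] fg; split; last by apply: pb_le S _ => x; rewrite fg.
exists c, tau; split=> //; split=> // x s /H; rewrite fg; apply.
Qed.

Lemma pt_size X Y (cX : coded X) (cY : coded Y) (f : X -> Y) :
  polytime f -> polybounded (fun x => sz (f x)).
Proof. by case. Qed.

Lemma eval_size e : exists C, forall s,
  (forall i, i <> 0 -> s i = Leaf) -> tsize (eval s e) <= C * tsize (s 0) + C.
Proof.
elim: e => [x||e1 [C1 H1] e2 [C2 H2]|e [C H]|e [C H]] /=.
- by exists 1 => s Hs; case: x => [|x]; rewrite ?(Hs x.+1) //=; lia.
- by exists 1 => s _; rewrite addn1.
- by exists (C1 + C2 + 1) => s Hs; have := H1 s Hs; have := H2 s Hs; lia.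
- by exists C.+1 => s Hs; have := H s Hs; case: (eval s e) => [|l r] /=; lia.
- by exists C.+1 => s Hs; have := H s Hs; case: (eval s e) => [|l r] /=; lia.
Qed.

Lemma pt_expr X Y (cX : coded X) (cY : coded Y) (f : X -> Y) e :
  (forall x s, s 0 = code x -> eval s e = code (f x)) -> polytime f.
Proof.
move=> H; split.
  exists (CAssign 0 e), (fun=> 1); split; last exact: pb_const.
  by split=> // x s sx; apply: runs_assign; rewrite /upd /= (H x).
have [C HC] := eval_size e.
apply: (pb_le (h := fun x => C * sz x + C)).
  by apply: pb_add (pb_const _); apply: pb_mul (pb_const _) pb_sz.
(* The hypothesis holds for every store with the input in variable 0; the one that is empty
   elsewhere meets the condition of [eval_size]. *)
move=> x; pose s := fun i : nat => if i is 0 then cX x else Leaf.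
by have := HC s; rewrite (H x s) //; apply; case.
Qed.

Lemma pt_comp X Y Z (cX : coded X) (cY : coded Y) (cZ : coded Z)
    (g : Y -> Z) (f : X -> Y) : polytime g -> polytime f -> polytime (fun x => g (f x)).
Proof.
move=> [[c2 [t2 [[D2 H2] B2]]] S2] [[c1 [t1 [[D1 H1] B1]]] S1]; split; last first.
  exact: (pb_comp (g := fun y => sz (g y))).
exists (CSeq c1 c2), (fun x => t1 x + t2 (f x) + 1); split; last first.
  by apply: pb_add (pb_const _); apply: pb_add => //; apply: pb_comp.
split=> [|x s sx]; first by rewrite /= D1 D2.
rewrite addn1; apply: runs_seq; apply: runs_le (H1 x s sx) (leqnn _) _ => s' /H2.
exact.
Qed.

Lemma pt_pair X Y Z (cX : coded X) (cY : coded Y) (cZ : coded Z)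
    (f : X -> Y) (g : X -> Z) : polytime f -> polytime g -> polytime (fun x => (f x, g x)).
Proof.
move=> [[c1 [t1 [H1 B1]]] S1] [[c2 [t2 [H2 B2]]] S2]; split; last first.
  apply: (pb_le (h := fun x => sz (f x) + sz (g x) + 1)).
    by apply: pb_add (pb_const _); apply: pb_add.
  by move=> x; rewrite sz_pair addn1.
(* Both calls work at address 2, so the input survives in variable 0 and the first result in
   variable 1. *)
exists (CSeq (CSeq (CSeq (CAssign 2 (EVar 0)) (cmd_shift 2 c1))
  (CSeq (CAssign 1 (EVar 2)) (CAssign 2 (EVar 0))))
  (CSeq (cmd_shift 2 c2) (CAssign 0 (ENode (EVar 1) (EVar 2))))).
exists (fun x => t1 x + t2 x + 9); split; last first.
  by apply: pb_add (pb_const _); apply: pb_add.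
split=> [|x s sx].
  by rewrite /= !deterministic_shift (proj1 H1) (proj1 H2).
apply: (runs_leT (T := (((1 + t1 x).+1 + (1 + 1).+1).+1 + (t2 x + 1).+1).+1));
  last by lia.
apply: runs_seq; apply: runs_seq; apply: runs_seq; apply: runs_assign.
apply: (runs_le (runs_call (x := x) (d := 2) H1 _) (leqnn _)).
  by rewrite /upd.
move=> s1 [E1 F1]; apply: runs_seq; apply: runs_assign; apply: runs_assign.
apply: runs_seq.
apply: (runs_le (runs_call (x := x) (d := 2) H2 _) (leqnn _)).
  by rewrite /upd /= F1.
move=> s2 [E2 F2]; apply: runs_assign; rewrite /upd /= E2 F2 //.
by rewrite /upd /= E1.
Qed.

Lemma pt_if X Y (cX : coded X) (cY : coded Y) (b : X -> bool) (f g : X -> Y) :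
  polytime b -> polytime f -> polytime g -> polytime (fun x => if b x then f x else g x).
Proof.
move=> [[c0 [t0 [H0 B0]]] S0] [[c1 [t1 [H1 B1]]] S1] [[c2 [t2 [H2 B2]]] S2].
split; last first.
  apply: (pb_le (h := fun x => sz (f x) + sz (g x))); first exact: pb_add.
  by move=> x; case: ifP => _; rewrite ?leq_addl ?leq_addr.
exists (CSeq (CSeq (CAssign 1 (EVar 0)) (cmd_shift 1 c0))
  (CIf (EVar 1) c1 c2)).
exists (fun x => t0 x + (t1 x + t2 x) + 9); split; last first.
  by apply: pb_add (pb_const _); apply: pb_add => //; apply: pb_add.
case: (H1) (H2) => [D1 E1] [D2 E2].
split=> [|x s sx].
  by rewrite /= !deterministic_shift (proj1 H0) D1 D2.
apply: (runs_leT (T := ((1 + t0 x).+1 + (t1 x + t2 x).+1).+1));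
  last by lia.
apply: runs_seq; apply: runs_seq; apply: runs_assign.
apply: (runs_le (runs_call (x := x) (d := 1) H0 _) (leqnn _)).
  by rewrite /upd.
move=> s1 [E0 F0]; apply: runs_if; rewrite /= E0.
have s10 : s1 0 = code x by rewrite F0.
case: (b x) => /=; first by apply: runs_le (E1 _ _ s10) (leq_addr _ _) _.
by apply: runs_le (E2 _ _ s10) (leq_addl _ _) _.
Qed.

(** The hypothesis [Hb] is what keeps bounded recursion polynomial: repeated
    doubling of the accumulator must be excluded. *)
Lemma pt_foldl X A B (cX : coded X) (cA : coded A) (cB : coded B)
    (f : X -> A -> B -> A) (a : X -> A) (l : X -> seq B) :
  polytime (fun z : X * (A * B) => f z.1 z.2.1 z.2.2) -> polytime a -> polytime l ->
  polybounded (fun x => \max_(n < (size (l x)).+1) sz (foldl (f x) (a x) (take n (l x)))) ->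
  polytime (fun x => foldl (f x) (a x) (l x)).
Proof.
move=> [[c [tau [H [d Bd]]]] S] [[ca [ta [Ha Ba]]] Sa] [[cl [tl [Hl Bl]]] Sl] Hb.
set M := fun x => _ in Hb.
have MP x n : sz (foldl (f x) (a x) (take n (l x))) <= M x.
  have [nl|nl] := ltnP n (size (l x)).+1.
    exact: (leq_bigmax (F := fun i : 'I_(size (l x)).+1 => _) (Ordinal nl)).
  rewrite take_oversize; last by apply: leq_trans nl; apply: leqnSn.
  have := leq_bigmax (F := fun i : 'I_(size (l x)).+1 =>
    sz (foldl (f x) (a x) (take i (l x)))) ord_max.
  by rewrite /= take_size.
split; last by apply: pb_le Hb _ => x; rewrite -{1}(take_size (l x)).
(* Bounds one call of [c] in every iteration; the [4] is two pair nodes plus the 2 built into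
   [polybounded]. *)
set B0 := fun x => (sz x + (M x + sz (l x)) + 4) ^ d : nat.
have bB : polybounded B0.
  apply: pb_exp; apply: pb_add (pb_const _); apply: pb_add pb_sz _.
  exact: pb_add.
pose body := CSeq (CAssign 3 (ENode (EVar 0) (ENode (EVar 1) (ELeft (EVar 2)))))
  (CSeq (cmd_shift 3 c)
  (CSeq (CAssign 1 (EVar 3)) (CAssign 2 (ERight (EVar 2))))).
exists (CSeq (CSeq (CSeq (CAssign 3 (EVar 0)) (cmd_shift 3 ca))
  (CSeq (CAssign 1 (EVar 3)) (CAssign 3 (EVar 0))))
  (CSeq (CSeq (cmd_shift 3 cl) (CAssign 2 (EVar 3)))
  (CSeq (CWhile (EVar 2) body) (CAssign 0 (EVar 1))))).
exists (fun x => ta x + tl x + (sz (l x) * (B0 x + 7) + 1) + 20); split; last first.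
  by do ![apply: pb_add => //|apply: pb_mul => //|apply: pb_const].
split=> [|x s sx].
  by rewrite /= !deterministic_shift (proj1 H) (proj1 Ha) (proj1 Hl).
have loop n (s1 : store) : n <= size (l x) -> s1 0 = code x ->
    s1 1 = code (foldl (f x) (a x) (take n (l x))) -> s1 2 = code (drop n (l x)) ->
    runs (CWhile (EVar 2) body) s1 ((size (l x) - n) * (B0 x + 7) + 1)
      (fun s' => s' 1 = code (foldl (f x) (a x) (l x))).
  move Dk: (size (l x) - n) => k; elim: k n s1 Dk => [|k IH] n s1 Dk nl s10 s11 s12.
    move: s11 s12; rewrite drop_oversize ?take_oversize; try by lia.
    by move=> s11 s12; apply: runs_whileF => //=; rewrite s12.
  have nl' : n < size (l x) by lia.
  have [b bE] : exists b, drop n (l x) = b :: drop n.+1 (l x).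
    case E : (l x) nl' => [//|b l'] nl'; exists (nth b (l x) n).
    by rewrite -E -drop_nth // E.
  have tE : take n.+1 (l x) = rcons (take n (l x)) b.
    by rewrite -addn1 takeD bE /= take0 cats1.
  apply: (runs_leT (T := ((1 + (B0 x + (1 + 1).+1).+1).+1 + (k * (B0 x + 7) + 1)).+1));
    last by lia.
  apply: runs_whileT; first by rewrite /= s12 bE.
  apply: runs_seq; apply: runs_assign; apply: runs_seq.
  have tau_le : tau (x, (foldl (f x) (a x) (take n (l x)), b)) <= B0 x.
    apply: leq_trans (Bd _) _; apply: leq_expl.
    rewrite !sz_pair; have := MP x n.
    have := sz_nth (s := l x) cB b nl'; rewrite -{1}[n]addn0 -nth_drop bE /=; move: (MP x n); lia.
  apply: (runs_le (runs_call
    (x := (x, (foldl (f x) (a x) (take n (l x)), b))) (d := 3) H _) tau_le).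
    by rewrite /upd /= s10 s11 s12 bE.
  move=> s2 [E2 F2]; apply: runs_seq; apply: runs_assign; apply: runs_assign.
  apply: (IH n.+1) => //; rewrite ?/upd /=; try by rewrite subnS Dk.
  - by rewrite F2.
  - by rewrite E2 /= tE foldl_rcons.
  - by rewrite F2 //= /upd /= s12 bE.
apply: (runs_leT (T := (((1 + ta x).+1 + (1 + 1).+1).+1 +
  ((tl x + 1).+1 + ((sz (l x) * (B0 x + 7) + 1) + 1).+1).+1).+1));
  last by lia.
apply: runs_seq; apply: runs_seq; apply: runs_seq; apply: runs_assign.
apply: (runs_le (runs_call (x := x) (d := 3) Ha _) (leqnn _)); first by rewrite /upd.
move=> s1 [E1 F1]; apply: runs_seq; apply: runs_assign; apply: runs_assign.
apply: runs_seq; apply: runs_seq.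
apply: (runs_le (runs_call (x := x) (d := 3) Hl _) (leqnn _)).
  by rewrite /upd /= F1.
move=> s2 [E2 F2]; apply: runs_assign; apply: runs_seq.
apply: (runs_le (loop 0 _ _ _ _ _)) => //; rewrite ?/upd /= ?take0 ?drop0 //.
- by rewrite F2 //= /upd /= F1.
- by rewrite F2 //= /upd /= E1.
- by rewrite subn0; apply: leq_add => //; apply: leq_mul => //; apply: ltnW; apply: size_sz.
by move=> s3 E3; apply: runs_assign.
Qed.

(** * Basic functions, lists and unary arithmetic in polynomial time *)

#[global] Instance coded_unit : coded unit := fun=> Leaf.

Section Closure.
Context {X : Type} {cX : coded X}.

Lemma pt_id : polytime (fun x : X => x).
Proof. by apply: (pt_expr (e := EVar 0)) => x s. Qed.

Fixpoint quote (t : tree) : expr :=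
  if t is Node l r then ENode (quote l) (quote r) else ELeaf.

Lemma eval_quote s t : eval s (quote t) = t.
Proof. by elim: t => //= l -> r ->. Qed.

Lemma pt_const Y (cY : coded Y) (y : Y) : polytime (fun _ : X => y).
Proof. by apply: (pt_expr (e := quote (code y))) => x s _; rewrite eval_quote. Qed.

Lemma pt_fst Y Z (cY : coded Y) (cZ : coded Z) (f : X -> Y * Z) :
  polytime f -> polytime (fun x => (f x).1).
Proof.
apply: (pt_comp (g := fst)).
by apply: (pt_expr (e := ELeft (EVar 0))) => x s /= ->.
Qed.

Lemma pt_snd Y Z (cY : coded Y) (cZ : coded Z) (f : X -> Y * Z) :
  polytime f -> polytime (fun x => (f x).2).
Proof.
apply: (pt_comp (g := snd)).
by apply: (pt_expr (e := ERight (EVar 0))) => x s /= ->.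
Qed.

Lemma pt_cons Y (cY : coded Y) (f : X -> Y) (g : X -> seq Y) :
  polytime f -> polytime g -> polytime (fun x => f x :: g x).
Proof.
move=> Hf Hg; apply: (pt_comp (g := fun z => z.1 :: z.2)) (pt_pair Hf Hg).
by apply: (pt_expr (e := EVar 0)) => x s /= ->.
Qed.

Lemma pt_behead Y (cY : coded Y) (f : X -> seq Y) :
  polytime f -> polytime (fun x => behead (f x)).
Proof.
apply: (pt_comp (g := behead)).
by apply: (pt_expr (e := ERight (EVar 0))) => -[|y x] s /= ->.
Qed.

Lemma pt_head0 (f : X -> seq nat) : polytime f -> polytime (fun x => head 0 (f x)).
Proof.
apply: (pt_comp (g := head 0)).
by apply: (pt_expr (e := ELeft (EVar 0))) => -[|y x] s /= ->.
Qed.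

Lemma pt_succ (f : X -> nat) : polytime f -> polytime (fun x => (f x).+1).
Proof.
apply: (pt_comp (g := S)).
by apply: (pt_expr (e := ENode ELeaf (EVar 0))) => x s /= ->.
Qed.

Lemma pt_pred (f : X -> nat) : polytime f -> polytime (fun x => (f x).-1).
Proof.
apply: (pt_comp (g := predn)).
by apply: (pt_expr (e := ERight (EVar 0))) => -[|x] s /= ->.
Qed.

(** A unary number and a list of that many units have the same code, so the identity program does
    it. This turns iteration up to a number into a fold. *)
Lemma pt_nseq (f : X -> nat) : polytime f -> polytime (fun x => nseq (f x) tt).
Proof.
apply: (pt_comp (g := fun n => nseq n tt)).
apply: (pt_expr (e := EVar 0)) => n s /= ->.
by elim: n => //= n IH; rewrite /code /= /code /= in IH *; rewrite IH.
Qed.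

Lemma pt_case Y B (cY : coded Y) (cB : coded B) (l : X -> seq B)
    (g : X -> B -> seq B -> Y) (h : X -> Y) :
  polytime l -> polytime (fun z : X * (B * seq B) => g z.1 z.2.1 z.2.2) -> polytime h ->
  polytime (fun x => if l x is y :: s then g x y s else h x).
Proof.
move=> [[c0 [t0 [H0 B0]]] S0] [[c1 [t1 [H1 B1]]] S1] [[c2 [t2 [H2 B2]]] S2].
have C (g' : X * (B * seq B) -> nat) : polybounded g' ->
    polybounded (fun x => if l x is y :: s then g' (x, (y, s)) else 0).
  move=> [d Hg]; apply: (pb_le (h := fun x => (sz x + sz (l x) + 4) ^ d)).
    by apply: pb_exp; apply: pb_add (pb_const _); apply: pb_add => //; apply: pb_sz.
  move=> x; case: (l x) => // y s; apply: leq_trans (Hg _) _; apply: leq_expl.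
  by rewrite !sz_pair sz_cons; lia.
split; last first.
  apply: pb_le (pb_add (C _ S1) S2) _ => x.
  by case: (l x) => [|y s] /=; rewrite ?leq_addr.
exists (CSeq (CSeq (CAssign 1 (EVar 0)) (cmd_shift 1 c0))
  (CIf (EVar 1) (CSeq (CAssign 0 (ENode (EVar 0) (EVar 1))) c1) c2)).
exists (fun x => t0 x + ((if l x is y :: s then t1 (x, (y, s)) else 0) + t2 x) + 9).
split; last by apply: pb_add (pb_const _); apply: pb_add => //; apply: pb_add => //; apply: C.
case: (H1) (H2) => [D1 E1] [D2 E2].
split=> [|x s sx].
  by rewrite /= !deterministic_shift (proj1 H0) D1 D2.
apply: (runs_leT (T := ((1 + t0 x).+1 +
  ((1 + (if l x is y :: s then t1 (x, (y, s)) else 0)).+1 + t2 x).+1).+1));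
  last by lia.
apply: runs_seq; apply: runs_seq; apply: runs_assign.
apply: (runs_le (runs_call (x := x) (d := 1) H0 _) (leqnn _)).
  by rewrite /upd.
move=> s1 [E0 F0]; apply: runs_if; rewrite /= E0.
have s10 : s1 0 = code x by rewrite F0.
case: (l x) E0 => [|y l'] /= E0.
  by apply: runs_le (E2 _ _ s10) (leq_addl _ _) _.
apply: runs_le (leq_addr _ _) _; last by move=> s'; exact.
apply: runs_seq; apply: runs_assign.
apply: runs_le (E1 (x, (y, l')) _ _) (leqnn _) _ => //.
by rewrite /upd /= s10 E0.
Qed.

End Closure.

Section Derived.
Context {X : Type} {cX : coded X}.

Lemma pt_nilp Y (cY : coded Y) (f : X -> seq Y) : polytime f -> polytime (fun x => nilp (f x)).
Proof.
move=> Hf; apply: pt_ext (pt_case (g := fun _ _ _ => false) Hf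
  (pt_const _ false) (pt_const _ true)) _ => x.
by case: (f x).
Qed.

Lemma pt_neg (f : X -> bool) : polytime f -> polytime (fun x => ~~ f x).
Proof.
move=> Hf; apply: pt_ext (pt_if Hf (pt_const _ false) (pt_const _ true)) _ => x.
by case: (f x).
Qed.

Lemma pt_and (f g : X -> bool) : polytime f -> polytime g -> polytime (fun x => f x && g x).
Proof.
move=> Hf Hg; apply: pt_ext (pt_if Hf Hg (pt_const _ false)) _ => x.
by case: (f x).
Qed.

Lemma pt_addb (f g : X -> bool) : polytime f -> polytime g -> polytime (fun x => f x != g x).
Proof.
move=> Hf Hg; apply: pt_ext (pt_if Hf (pt_neg Hg) Hg) _ => x.
by case: (f x); case: (g x).
Qed.

Lemma pt_fold A B (cA : coded A) (cB : coded B)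
    (f : X -> A -> B -> A) (a : X -> A) (l : X -> seq B) (h : X -> nat) :
  polytime (fun z : X * (A * B) => f z.1 z.2.1 z.2.2) -> polytime a -> polytime l ->
  polybounded h ->
  (forall x n, n <= size (l x) -> sz (foldl (f x) (a x) (take n (l x))) <= h x) ->
  polytime (fun x => foldl (f x) (a x) (l x)).
Proof.
move=> Hf Ha Hl Hh H; apply: pt_foldl => //; apply: pb_le Hh _ => x.
by apply/bigmax_leqP => i _; apply: H; rewrite -ltnS.
Qed.

Lemma pt_rev B (cB : coded B) (l : X -> seq B) : polytime l -> polytime (fun x => rev (l x)).
Proof.
have E (s1 s2 : seq B) : foldl (fun s y => y :: s) s2 s1 = catrev s1 s2.
  by elim: s1 s2 => //= y s1 IH s2; rewrite IH.
move=> Hl; apply: (@pt_ext _ _ _ _ (fun x => foldl (fun s y => y :: s) [::] (l x))) => [|x].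
  apply: (pt_fold (h := fun x => sz (l x))) => //.
  - exact: (pt_cons (pt_snd (pt_snd pt_id)) (pt_fst (pt_snd pt_id))).
  - exact: pt_const.
  - exact: pt_size.
  move=> x n nl; rewrite E -[X in sz X <= _]/(rev _).
  have -> : sz (rev (take n (l x))) = sz (take n (l x)).
    elim: (take n (l x)) => // y s IH; rewrite rev_cons -cats1 sz_cons -IH.
    by elim: (rev s) => // z s' IHs; rewrite /= !sz_cons IHs; lia.
  by elim: (l x) n nl => [|y s IH] [|n] //=; rewrite !sz_cons ltnS => /IH; lia.
by rewrite E.
Qed.

Lemma pt_map B C (cB : coded B) (cC : coded C) (f : X -> B -> C) (l : X -> seq B) :
  polytime (fun z : X * B => f z.1 z.2) -> polytime l -> polytime (fun x => map (f x) (l x)).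
Proof.
move=> Hf Hl.
have E x : map (f x) (l x) = rev (foldl (fun s y => f x y :: s) [::] (l x)).
  rewrite -[LHS]revK; congr rev.
  have H s : foldl (fun s y => f x y :: s) s (l x) = catrev (map (f x) (l x)) s.
    by elim: (l x) s => //= y l' IH s; rewrite IH.
  by rewrite H.
apply: pt_ext (fun x => esym (E x)); apply: pt_rev.
have [d Hd] := pt_size Hf.
apply: (pt_fold (h := fun x => sz (l x) * ((sz x + sz (l x) + 3) ^ d).+1 + 1)) => //.
- apply: pt_cons; last exact: (pt_fst (pt_snd pt_id)).
  apply: (pt_comp (g := fun z => f z.1 z.2) (f := fun z => (z.1, z.2.2)) Hf).
  exact: (pt_pair (pt_fst pt_id) (pt_snd (pt_snd pt_id))).
- exact: pt_const.
- apply: pb_add (pb_const _); apply: pb_mul; first exact: pt_size.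
  apply: (pb_le (h := fun x => (sz x + sz (l x) + 3) ^ d + 1)); last by move=> x; rewrite addn1.
  apply: pb_add (pb_const _); apply: pb_exp; apply: pb_add (pb_const _).
  by apply: pb_add pb_sz _; apply: pt_size.
move=> x n nl;
have Hn (y : B) k : k < size (l x) -> sz (f x (nth y (l x) k)) <= (sz x + sz (l x) + 3) ^ d.
  move=> kl; apply: leq_trans (Hd (x, _)) _; apply: leq_expl.
  by rewrite sz_pair; have := sz_nth cB y kl; lia.
have H k : k <= size (l x) ->
    sz (foldl (fun s y => f x y :: s) [::] (take k (l x)))
      <= k * ((sz x + sz (l x) + 3) ^ d).+1 + 1.
  elim: k => [|k IH] kl; first by rewrite take0.
  have y0 : B by case: (l x) kl.
  rewrite (take_nth y0) // foldl_rcons sz_cons mulSn.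
  have := IH (ltnW kl); have := Hn y0 k kl; lia.
apply: leq_trans (H n nl) _; rewrite leq_add2r leq_mul2r.
by have := size_sz cB (l x); lia.
Qed.

Lemma pt_cat B (cB : coded B) (l1 l2 : X -> seq B) :
  polytime l1 -> polytime l2 -> polytime (fun x => l1 x ++ l2 x).
Proof.
move=> H1 H2.
have E s1 (s2 : seq B) : foldl (fun s y => y :: s) s2 s1 = rev s1 ++ s2.
  by elim: s1 s2 => //= y s1 IH s2; rewrite IH rev_cons cat_rcons.
apply: (@pt_ext _ _ _ _ (fun x => foldl (fun s y => y :: s) (l2 x) (rev (l1 x)))) => [|x].
  have H3 := pt_rev H1.
  apply: (pt_fold (h := fun x => sz (rev (l1 x)) + sz (l2 x))) => //.
  - exact: (pt_cons (pt_snd (pt_snd pt_id)) (pt_fst (pt_snd pt_id))).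
  - by apply: pb_add; apply: pt_size.
  move=> x n _; move: (rev (l1 x)) (l2 x) => s1 s2.
  by elim: s1 n s2 => [|y s1 IH] [|n] s2 //=; rewrite ?leq_addl //;
    apply: leq_trans (IH _ _) _; rewrite !sz_cons; lia.
by rewrite E revK.
Qed.

End Derived.

Section Flatten.
Context {X : Type} {cX : coded X}.

Lemma pt_flatten B (cB : coded B) (l : X -> seq (seq B)) :
  polytime l -> polytime (fun x => flatten (l x)).
Proof.
move=> H.
have E s (ss : seq (seq B)) : foldl cat s ss = s ++ flatten ss.
  by elim: ss s => [|s1 ss IH] s /=; rewrite ?cats0 // IH catA.
apply: (@pt_ext _ _ _ _ (fun x => foldl cat [::] (l x))) => [|x]; last by rewrite E.
apply: (pt_fold (h := fun x => sz (l x))) => //.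
- exact: (pt_cat (pt_fst (pt_snd pt_id)) (pt_snd (pt_snd pt_id))).
- exact: pt_const.
- exact: pt_size.
move=> x n _; rewrite E cat0s.
elim: (l x) n => [|s ss IH] [|n] //=; rewrite !sz_cons.
by have := sz_cat cB s (flatten (take n ss)); have := IH n; lia.
Qed.

Lemma pt_all B (cB : coded B) (p : X -> B -> bool) (l : X -> seq B) :
  polytime (fun z : X * B => p z.1 z.2) -> polytime l -> polytime (fun x => all (p x) (l x)).
Proof.
move=> Hp Hl.
apply: (@pt_ext _ _ _ _ (fun x => foldl (fun b y => b && p x y) true (l x))) => [|x].
  apply: (pt_fold (h := fun=> 3)) => //; last by move=> *; apply: sz_bool.
  - apply: pt_and; first exact: (pt_fst (pt_snd pt_id)).
    apply: (pt_comp (g := fun z => p z.1 z.2) (f := fun z => (z.1, z.2.2)) Hp).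
    exact: (pt_pair (pt_fst pt_id) (pt_snd (pt_snd pt_id))).
  - exact: pt_const.
  - exact: pb_const.
have H b : foldl (fun b y => b && p x y) b (l x) = b && all (p x) (l x).
  by elim: (l x) b => [|y s IH] b /=; rewrite ?andbT // IH andbA.
by rewrite H.
Qed.

Lemma foldl_nseq A B (f : A -> A) (b : B) n a :
  foldl (fun a _ => f a) a (nseq n b) = iter n f a.
Proof. by elim: n a => //= n IH a; rewrite IH -iterSr. Qed.

Lemma take_nseq B (b : B) m n : m <= n -> take m (nseq n b) = nseq m b.
Proof. by elim: m n => [|m IH] [|n] //=; rewrite ?take0 // => /IH ->. Qed.

Lemma pt_sub (f g : X -> nat) : polytime f -> polytime g -> polytime (fun x => f x - g x).
Proof.
move=> Hf Hg.
apply: (@pt_ext _ _ _ _ (fun x => foldl (fun n _ => n.-1) (f x) (nseq (g x) tt))) => [|x].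
  apply: (pt_fold (h := fun x => sz (f x))) => //.
  - exact: (pt_pred (pt_fst (pt_snd pt_id))).
  - exact: pt_nseq.
  - exact: pt_size.
  move=> x n; rewrite size_nseq => ng; rewrite take_nseq // foldl_nseq.
  by rewrite iter_predn !sz_nat; lia.
by rewrite foldl_nseq iter_predn.
Qed.

Lemma pt_add (f g : X -> nat) : polytime f -> polytime g -> polytime (fun x => f x + g x).
Proof.
move=> Hf Hg.
apply: (@pt_ext _ _ _ _ (fun x => foldl (fun n _ => n.+1) (f x) (nseq (g x) tt))) => [|x].
  apply: (pt_fold (h := fun x => sz (f x) + sz (g x))) => //.
  - exact: (pt_succ (pt_fst (pt_snd pt_id))).
  - exact: pt_nseq.
  - by apply: pb_add; apply: pt_size.
  move=> x n; rewrite size_nseq => ng; rewrite take_nseq // foldl_nseq.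
  by rewrite iter_succn !sz_nat; lia.
by rewrite foldl_nseq iter_succn.
Qed.

Lemma pt_drop B (cB : coded B) (f : X -> nat) (l : X -> seq B) :
  polytime f -> polytime l -> polytime (fun x => drop (f x) (l x)).
Proof.
move=> Hf Hl.
have E n (s : seq B) : iter n behead s = drop n s.
  by elim: n s => [|n IH] s; rewrite ?drop0 // iterSr IH; case: s.
apply: (@pt_ext _ _ _ _ (fun x => foldl (fun s _ => behead s) (l x) (nseq (f x) tt))) => [|x].
  apply: (pt_fold (h := fun x => sz (l x))) => //.
  - exact: (pt_behead (pt_fst (pt_snd pt_id))).
  - exact: pt_nseq.
  - exact: pt_size.
  move=> x n; rewrite size_nseq => ng; rewrite take_nseq // foldl_nseq E.
  elim: (l x) n {ng} => [|y s IH] [|n] //=; rewrite sz_cons.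
  by apply: leq_trans (IH n) _; lia.
by rewrite foldl_nseq E.
Qed.

Lemma pt_is0 (f : X -> nat) : polytime f -> polytime (fun x => f x == 0).
Proof.
move=> Hf; apply: pt_ext (pt_nilp (pt_nseq Hf)) _ => x.
by case: (f x).
Qed.

Lemma pt_leq (f g : X -> nat) : polytime f -> polytime g -> polytime (fun x => f x <= g x).
Proof. by move=> Hf Hg; apply/pt_is0/pt_sub. Qed.

Lemma pt_eqn (f g : X -> nat) : polytime f -> polytime g -> polytime (fun x => f x == g x).
Proof.
move=> Hf Hg; apply: pt_ext (pt_and (pt_leq Hf Hg) (pt_leq Hg Hf)) _ => x.
by rewrite eqn_leq.
Qed.

Lemma pt_length B (cB : coded B) (l : X -> seq B) : polytime l -> polytime (fun x => size (l x)).
Proof.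
move=> Hl.
have E (s : seq B) n : foldl (fun n _ => n.+1) n s = size s + n.
  by elim: s n => //= y s IH n; rewrite IH addnS.
apply: (@pt_ext _ _ _ _ (fun x => foldl (fun n _ => n.+1) 0 (l x))) => [|x].
  apply: (pt_fold (h := fun x => sz (l x) + sz (l x))) => //.
  - exact: (pt_succ (pt_fst (pt_snd pt_id))).
  - exact: pt_const.
  - by apply: pb_add; apply: pt_size.
  move=> x n nl; rewrite E addn0 sz_nat size_take_min.
  by have := size_sz cB (l x); lia.
by rewrite E addn0.
Qed.

End Flatten.

Ltac pt_step :=
  cbv beta;
  match goal with
  | |- polytime (fun x => x) => exact: pt_id
  | |- polytime fst => (apply: pt_fst; exact: pt_id)
  | |- polytime snd => (apply: pt_snd; exact: pt_id)
  | |- polytime (fun _ => ?c) => exact: pt_const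
  | |- polytime (fun x => @?f x != @?g x) => apply: pt_addb
  | |- polytime (fun x => ~~ @?f x) => apply: pt_neg
  | |- polytime (fun x => (@?f x).1) => apply: pt_fst
  | |- polytime (fun x => (@?f x).2) => apply: pt_snd
  | |- polytime (fun x => (@?f x, @?g x)) => apply: pt_pair
  | |- polytime (fun x => @?f x :: @?g x) => apply: pt_cons
  | |- polytime (fun x => behead (@?f x)) => apply: pt_behead
  | |- polytime (fun x => head 0 (@?f x)) => apply: pt_head0
  | |- polytime (fun x => (@?f x).-1) => apply: pt_pred
  | |- polytime (fun x => @?f x && @?g x) => apply: pt_and
  | |- polytime (fun x => @?f x == 0) => apply: pt_is0
  | |- polytime (fun x => @?f x == @?g x) => apply: pt_eqn
  | |- polytime (fun x => @?f x <= @?g x) => apply: pt_leq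
  | |- polytime (fun x => @?f x - @?g x) => apply: pt_sub
  | |- polytime (fun x => @?f x + @?g x) => apply: pt_add
  | |- polytime (fun x => size (@?f x)) => apply: pt_length
  | |- polytime (fun x => rev (@?f x)) => apply: pt_rev
  | |- polytime (fun x => @?f x ++ @?g x) => apply: pt_cat
  | |- polytime (fun x => flatten (@?f x)) => apply: pt_flatten
  | |- polytime (fun x => drop (@?f x) (@?g x)) => apply: pt_drop
  | |- polytime (fun x => nseq (@?f x) tt) => apply: pt_nseq
  | |- polytime (fun x => (@?f x).+1) => apply: pt_succ
  end.
Ltac pt_auto := repeat (first [assumption | pt_step]).

(** * The reduction *)

Definition conflict (x y : literal) := (x.1 == y.1) && (x.2 != y.2).

Definition consistent (s : seq literal) :=
  all (fun x => all (fun y => ~~ conflict x y) s) s.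

(** A selector pointing outside the clause yields two contradictory literals,
    so that it is never part of a consistent choice. *)
Definition select (c : seq literal) (t : nat) : seq literal :=
  if drop t c is x :: _ then [:: x] else [:: (0, true); (0, false)].

(** Surplus letters of [w] are ignored, so groups with fewer than [h] clauses, row 0 included, can
    use the words of length [h]. *)
Definition selected (g : seq (seq literal)) (w : seq nat) : seq literal :=
  (foldl (fun st c => (behead st.1, select c (head 0 st.1) ++ st.2))
    (w, [::]) g).2.

(** The tag is the row index; it tells apart rows with the same clauses. *)
Definition row := (nat * seq (seq literal))%type.

Definition compatible (u v : row * seq nat) :=
  (u.1.1 != v.1.1) && consistent (selected u.1.2 u.2 ++ selected v.1.2 v.2).

Lemma consistentP s :
  reflect {in s &, forall x y, ~~ conflict x y} (consistent s).
Proof.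
apply: (iffP allP) => [H x y xs ys|H x xs].
  by move/allP: (H x xs); apply.
by apply/allP => y ys; apply: H.
Qed.

Lemma mem_selected g w x : x \in selected g w =
  has (fun i => x \in select (nth [::] g i) (nth 0 w i)) (iota 0 (size g)).
Proof.
rewrite /selected; set f := fun _ _ => _.
suff H acc : x \in (foldl f (w, acc) g).2 =
    (x \in acc) || has (fun i => x \in select (nth [::] g i) (nth 0 w i)) (iota 0 (size g)).
  by rewrite H.
elim: g w acc => [|c g IH] w acc /=; first by rewrite orbF.
rewrite IH mem_cat nth0 (iotaDl 1 0) has_map orbA; congr (_ || _); first exact: orbC.
by apply: eq_has => i /=; rewrite nth_behead.
Qed.

Lemma compatible_sym : symmetric compatible.
Proof.
move=> u v; rewrite /compatible eq_sym; congr (_ && _).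
apply/consistentP/consistentP => H x y xs ys; apply: H;
  by rewrite mem_cat orbC -mem_cat.
Qed.

(** * Words over three letters and the group size *)

Definition expand (L : seq (seq nat)) : seq (seq nat) :=
  [seq 0 :: w | w <- L] ++ [seq 1 :: w | w <- L] ++ [seq 2 :: w | w <- L].

Definition words h := iter h expand [:: [::]].

Lemma size_words h : size (words h) = 3 ^ h.
Proof.
elim: h => // h IH.
by rewrite /words iterS -/(words h) /expand !size_cat !size_map IH expnS; lia.
Qed.

Lemma mem_words h w : (w \in words h) = (size w == h) && all (fun t => t < 3) w.
Proof.
elim: h w => [|h IH] w; first by rewrite /words /= inE; case: w.
rewrite /words iterS -/(words h) /expand !mem_cat.
have E t (v : seq nat) : (v \in [seq t :: w | w <- words h]) =
    if v is t' :: v' then (t' == t) && (v' \in words h) else false.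
  case: v => [|t' v']; first by apply/mapP => -[].
  apply/mapP/andP => [[v vw [-> ->]]|[/eqP -> vw]]; last by exists v'.
  by rewrite eqxx.
rewrite !E; case: w => [//|t w]; rewrite IH /= eqSS.
by case: t => [|[|[|t]]]; rewrite /= ?orbF ?andbF.
Qed.

(** Computes the least group size [h >= 1] with [m < 9 ^ h], together with
    [9 ^ h] and the words of length [h]. *)
Definition scale_step m (st : nat * (nat * seq (seq nat))) :=
  if st.2.1 <= m then
    (st.1.+1, (st.2.1 + (st.2.1 + st.2.1) +
      (st.2.1 + (st.2.1 + st.2.1) + (st.2.1 + (st.2.1 + st.2.1))),
      expand st.2.2))
  else st.

Definition scale (F : seq (seq literal)) :=
  foldl (fun st _ => scale_step (size F) st) (1, (9, words 1)) F.

Definition scaled h := (h, (9 ^ h, words h)).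

(** The nested sums in [scale_step] are a multiplication by 9 written with additions. *)
Lemma scale_stepE m h : scale_step m (scaled h) =
  scaled (if 9 ^ h <= m then h.+1 else h).
Proof.
rewrite /scale_step /=; case: ifP => // _; rewrite /scaled; congr (_, (_, _)).
by rewrite expnS; lia.
Qed.

(** Either the threshold is passed or every step has multiplied the power by 9, which then exceeds
    [n]; hence [m] steps suffice and the clause list can serve as a clock. The factor 9 is the
    overshoot of the last step, and [maxn m 1] covers [m = 0], where [h = 1]. *)
Lemma scale_iter m n : exists h,
  [/\ iter n (scale_step m) (scaled 1) = scaled h, 0 < h,
      9 ^ h <= 9 * maxn m 1 & (m < 9 ^ h) || (n < 9 ^ h)].
Proof.
elim: n => [|n [h [E h0 hm H]]]; first by exists 1; split=> //; lia.
rewrite iterS E scale_stepE; case: ifP => hm'; last first.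
  by exists h; split=> //; rewrite ltnNge hm'.
by exists h.+1; split=> //; rewrite ?expnS; move: hm H hm'; lia.
Qed.

(** The counter [st.1] is the number of free places in the row under construction, which is the head
    of [st.2]. Starting it at 0 keeps row 0 empty. *)
Definition add_clause h (st : nat * seq row) (c : seq literal) : nat * seq row :=
  if st.2 is r :: rs then
    if st.1 == 0 then (h.-1, (r.1.+1, [:: c]) :: st.2)
    else (st.1.-1, (r.1, c :: r.2) :: rs)
  else st.

(** Row 0 is an empty group: its edges check that the choice made in each other
    row is consistent by itself, even if there is only one such row. *)
Definition rows h F : seq row := (foldl (add_clause h) (0, [:: (0, [::])]) F).2.

Lemma rev_iotaS n : rev (iota 0 n.+1) = n :: rev (iota 0 n).
Proof. by rewrite -addn1 iotaD rev_cat. Qed.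

(** The fourth conjunct counts places: [h] in every row but row 0, of which [st.1] are still free.
    The last one strengthens the induction so that no row outgrows [h]. *)
Lemma rows_invariant h F : 0 < h ->
  let st := foldl (add_clause h) (0, [:: (0, [::])]) F in
  [/\ [seq r.1 | r <- st.2] = rev (iota 0 (size st.2)),
      flatten [seq r.2 | r <- st.2] =i F,
      all (fun r => size r.2 <= h) st.2,
      st.1 + size F = h * (size st.2).-1 /\ st.1 < h &
      0 < size st.2 /\ size (head (0, [::]) st.2).2 + st.1 <= h].
Proof.
move=> h0; elim/last_ind: F => [|F c] /=; first by split=> //; split=> //; lia.
rewrite foldl_rcons; set st := foldl _ _ _; case: st => n [|[t g] rs].
  by case=> _ _ _ _ [].
case=> Ht Hm Hs [Hn nh] [_ Hg]; rewrite /= in Hm Hs Hn nh Hg.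
move: Ht; rewrite [size _]/= rev_iotaS /= => -[tE Ht].
case/andP: Hs => gh Ha; rewrite /add_clause [(_, _).2]/= [(_, _).1]/=.
case: (n =P 0) => [n0|/eqP n0]; split.
- by rewrite [size _]/= !rev_iotaS /= tE Ht.
- by move=> x; rewrite mem_rcons inE -Hm /= inE.
- by rewrite /= gh h0.
- by rewrite size_rcons /=; split; [move: Hn; rewrite n0 /= mulnS|]; lia.
- by split=> //=; lia.
- by rewrite [size _]/= !rev_iotaS /= tE Ht.
- by move=> x; rewrite mem_rcons inE -Hm /= inE.
- by rewrite /= Ha andbT; lia.
- by rewrite size_rcons /=; split; lia.
- by split=> //=; lia.
Qed.

Definition adjacency (rs : seq row) (cs : seq (seq nat)) :=
  [seq [seq [seq [seq compatible (r, w) (r', w') | w' <- cs] | r' <- rs]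
    | w <- cs] | r <- rs].

Section RowColumnGraph.
Variables (rs : seq row) (cs : seq (seq nat)).
Let k := size rs.

Definition cell (u : 'I_k * 'I_k) := (nth (0, [::]) rs u.1, nth [::] cs u.2).

Definition graph_adj : rel ('I_k * 'I_k) := fun u v => compatible (cell u) (cell v).

Lemma graph_sym : symmetric graph_adj.
Proof. by move=> u v; apply: compatible_sym. Qed.

Lemma graph_irr : irreflexive graph_adj.
Proof. by move=> u; rewrite /graph_adj /compatible eqxx. Qed.

Definition graph := SGraph graph_sym graph_irr.

Lemma enc_seq_map X Y (f : X -> Y) (e : Y -> tree) s :
  enc_seq e (map f s) = enc_seq (e \o f) s.
Proof. by rewrite /enc_seq foldr_map. Qed.

Lemma enc_seq_nth X (e : X -> tree) x0 s n : size s = n ->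
  enc_seq e s = enc_seq (fun i : 'I_n => e (nth x0 s i)) (enum 'I_n).
Proof.
move=> sn; rewrite -[LHS](congr1 (enc_seq e) (mkseq_nth x0 s)).
by rewrite /mkseq enc_seq_map sn -val_enum_ord enc_seq_map.
Qed.

Lemma eq_enc_seq X (e1 e2 : X -> tree) : e1 =1 e2 -> enc_seq e1 =1 enc_seq e2.
Proof. by move=> E; elim=> //= x s ->; rewrite E. Qed.

(** The four nested maps visit the cells in the order of [enc_table], so the computed tree is
    exactly the input of the decider. *)
Lemma enc_graph : size cs = k -> enc_table_graph graph = code (adjacency rs cs).
Proof.
move=> csk; rewrite /enc_table_graph /enc_table /code /coded_seq /adjacency.
rewrite enc_seq_map (enc_seq_nth _ (0, [::]) (n := k)) //.
apply: eq_enc_seq => i /=; rewrite /code enc_seq_map (enc_seq_nth _ [::] csk).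
apply: eq_enc_seq => j /=; rewrite /code enc_seq_map (enc_seq_nth _ (0, [::]) (n := k)) //.
apply: eq_enc_seq => i' /=; rewrite /code enc_seq_map (enc_seq_nth _ [::] csk).
by [].
Qed.

End RowColumnGraph.

(** [multisets c n acc] lists, up to order, the extensions of [acc] by [n]
    elements of [c] with repetitions. *)
Fixpoint multisets (X : Type) (c : seq X) : nat -> seq X -> seq (seq X) :=
  fix go n acc :=
    match n, c with
    | 0, _ => [:: acc]
    | _.+1, [::] => [::]
    | n'.+1, x :: c' => go n' (x :: acc) ++ multisets c' n acc
    end.

Lemma size_multisets (X : eqType) (c : seq X) n acc s :
  s \in multisets c n acc -> size s = n + size acc.
Proof.
elim: c n acc => [|x c IHc]; first by case=> //= acc; rewrite inE => /eqP ->.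
elim=> [|n IHn] acc; first by rewrite /= inE => /eqP ->.
by rewrite /= mem_cat => /orP[/IHn|/IHc] -> //=; rewrite addnS.
Qed.

(** The first letter is spent once for each occurrence in [t] and then dropped. This loses the order
    of [t], hence [perm_eq]. *)
Lemma multisets_complete (X : eqType) (c : seq X) t acc : {subset t <= c} ->
  exists2 s, s \in multisets c (size t) acc & perm_eq s (t ++ acc).
Proof.
elim: c t acc => [|x c IHc] t acc.
  case: t => [|y t] H; last by have := H y (mem_head _ _).
  by exists acc => //; rewrite /= inE.
move Dn: (size t) => n; elim: n t Dn acc => [|n IHn] t Dn acc tc.
  by exists acc; rewrite ?inE // (size0nil Dn).
have [xt|xt] := boolP (x \in t).
  have xt_rem := perm_to_rem xt.
  have [||s sm sp] := IHn (rem x t) _ (x :: acc).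
  - by rewrite size_rem // Dn.
  - by move=> y /mem_rem /tc.
  exists s; first by rewrite /= mem_cat sm.
  apply: perm_trans sp _; rewrite perm_sym -cat_rcons perm_cat2r.
  by apply: perm_trans xt_rem _; rewrite perm_sym perm_rcons.
have [|s sm sp] := IHc t acc.
  move=> y yt; have := tc y yt; rewrite inE => /predU1P[yx|//].
  by rewrite yx in yt; rewrite yt in xt.
by exists s => //; rewrite /= mem_cat -Dn sm orbT.
Qed.

(** The future clique: each row is sent to a column carrying its word, and repeated words get
    different columns. *)
Lemma perm_eq_nth (T : eqType) (x0 : T) (s t : seq T) k : size t = k -> perm_eq s t ->
  exists rho : 'S_k, forall i : 'I_k, nth x0 s i = nth x0 t (rho i).
Proof.
move=> sk; have tk : size t == k by apply/eqP.
rewrite -[t]/(tval (Tuple tk)) => /tuple_permP[rho ->].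
by exists rho => i; rewrite -tnth_nth tnth_mktuple (tnth_nth x0).
Qed.

(** * Permutation cliques versus satisfying assignments *)

Section Correctness.
Variables (h : nat) (F : seq (seq literal)).
Hypothesis h0 : 0 < h.
Let rs := rows h F.
Let k := size rs.

Lemma rows_tags i j : i < k -> j < k -> i != j ->
  (nth (0, [::]) rs i).1 != (nth (0, [::]) rs j).1.
Proof.
move=> ik jk; rewrite -!(nth_map _ 0 (fun r : row => r.1)) // nth_uniq ?size_map //.
have [-> _ _ _ _] := rows_invariant F h0.
by rewrite rev_uniq iota_uniq.
Qed.

Lemma mem_row c : c \in F -> exists2 i, i < k & c \in (nth (0, [::]) rs i).2.
Proof.
have [_ <- _ _ _] := rows_invariant F h0; rewrite -/(rows h F) -/rs.
case/flattenP => _ /mapP[r rrs ->] cr; exists (index r rs); first by rewrite index_mem.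
by rewrite nth_index.
Qed.

Lemma row_mem i c : i < k -> c \in (nth (0, [::]) rs i).2 -> c \in F.
Proof.
have [_ <- _ _ _] := rows_invariant F h0; rewrite -/(rows h F) -/rs => ik cr.
by apply/flattenP; exists (nth (0, [::]) rs i).2 => //; apply/mapP; eexists => //; apply: mem_nth.
Qed.

Lemma row_size i : i < k -> size (nth (0, [::]) rs i).2 <= h.
Proof.
have [_ _ /allP H _ _] := rows_invariant F h0 => ik.
by apply: H; apply: mem_nth.
Qed.

(** Any column labels will do, because the edges alone force the choices to be consistent. A
    variable is set to true exactly when its positive literal is chosen in some row. *)
Lemma clique_sat cs : has_permutation_clique (graph rs cs) ->
  exists a : nat -> bool, all (has (fun l => a l.1 == l.2)) F.
Proof.
case=> rho C; case: (posnP (size F)) => [/size0nil F0|Fpos].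
  by exists xpredT; rewrite F0.
have k2 : 1 < k.
  have [_ _ _ [H _] _] := rows_invariant F h0; move: H.
  by rewrite -/(rows h F) -/rs -/k; case: k => [|[|]] //=; rewrite muln0; lia.
pose S (i : 'I_k) := selected (nth (0, [::]) rs i).2 (nth [::] cs (rho i)).
have adj (i j : 'I_k) : i != j -> consistent (S i ++ S j).
  move=> ij; have : graph rs cs (i, rho i) (j, rho j).
    apply: C; try by apply/imsetP; eexists.
    by apply: contra ij => /eqP[->].
  by case/andP.
have ok (i j : 'I_k) x y : x \in S i -> y \in S j -> ~~ conflict x y.
  move=> xi yj; have [ij|ij] := eqVneq i j; last first.
    by move/consistentP: (adj _ _ ij); apply; rewrite mem_cat ?xi ?yj ?orbT.
  (* Consistency within row [i] is read off an edge to another row: row 1 if [i] is row 0, and row 0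
     otherwise. *)
  have [i' ii'] : exists i' : 'I_k, i != i'.
    case: (posnP i) => [i0|i0]; first by exists (Ordinal k2); rewrite -val_eqE /= i0.
    by exists (Ordinal (ltnW k2)); rewrite -val_eqE /= -lt0n.
  by move/consistentP: (adj _ _ ii'); apply; rewrite mem_cat ?xi ?ij ?yj.
exists (fun v => [exists i : 'I_k, (v, true) \in S i]); apply/allP => c /mem_row[n nk cn].
pose i := Ordinal nk; set t := nth 0 (nth [::] cs (rho i)) (index c (nth (0, [::]) rs n).2).
have sub x : x \in select c t -> x \in S i.
  move=> xs; rewrite mem_selected; apply/hasP; exists (index c (nth (0, [::]) rs n).2).
    by rewrite mem_iota index_mem.
  by rewrite nth_index.
move: sub; rewrite /select; case E : (drop t c) => [|x d] sub; last first.
  have xS : x \in S i by apply: sub; rewrite mem_head.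
  apply/hasP; exists x; first by apply: (mem_drop (n0 := t)); rewrite E mem_head.
  case: x xS {E sub} => v [] xS /=.
    by apply/eqP/existsP; exists i.
  apply/eqP/negbTE/existsP => -[j jS].
  by have := ok _ _ _ _ xS jS; rewrite /conflict /= eqxx.
(* Here the selector points outside its clause, so both literals of variable 0 are selected, against
   [ok]. *)
have := ok i i _ _ (sub (0, true) _) (sub (0, false) _); rewrite !inE eqxx ?orbT /=.
by move/(_ isT isT).
Qed.

(** Choosing in each clause the first literal true under [a] gives only true literals, and these
    never conflict. Padding with zeros brings the words to the common length [h]. *)
Lemma sat_clique (a : nat -> bool) : all (fun c => size c <= 3) F ->
  all (has (fun l => a l.1 == l.2)) F ->
  exists2 cs, cs \in multisets (words h) k [::] & has_permutation_clique (graph rs cs).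
Proof.
move=> F3 sat; pose sel c := find (fun l : literal => a l.1 == l.2) c.
pose word (r : row) := map sel r.2 ++ nseq (h - size r.2) 0.
have [|cs csm csp] := @multisets_complete _ (words h) (map word rs) [::].
  move=> _ /mapP[r rrs ->]; rewrite mem_words size_cat size_map size_nseq.
  have ri : r = nth (0, [::]) rs (index r rs) by rewrite nth_index.
  have rk : index r rs < k by rewrite index_mem.
  rewrite subnKC ?eqxx /=; last by rewrite ri row_size.
  rewrite all_cat all_nseq orbT andbT all_map; apply/allP => c cr /=.
  have cF : c \in F by apply: row_mem rk _; rewrite -ri.
  apply: leq_trans (allP F3 c cF); rewrite -has_find; exact: (allP sat).
rewrite size_map in csm; exists cs => //; rewrite cats0 perm_sym in csp.
have csk : size cs = k by rewrite (size_multisets csm) addn0.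
have [rho rhoP] := perm_eq_nth [::] csk csp.
have good (i : 'I_k) x : x \in selected (nth (0, [::]) rs i).2 (nth [::] cs (rho i)) ->
    a x.1 = x.2.
  rewrite -rhoP (nth_map (0, [::])) // mem_selected => /hasP[p].
  rewrite mem_iota add0n /= => pi; rewrite /word nth_cat size_map pi (nth_map [::]) //.
  set c := nth [::] _ p.
  have cF : c \in F by apply: row_mem (ltn_ord i) _; apply: mem_nth.
  have hc := allP sat c cF; have := hc; rewrite has_find => hf.
  rewrite /select (drop_nth (0, true)) // inE => /eqP ->.
  exact/eqP/(nth_find _ hc).
exists rho => _ _ /imsetP[i _ ->] /imsetP[j _ ->] ij.
apply/andP; split=> /=.
  by apply: rows_tags => //; apply: contra ij => /eqP/val_inj ->.
apply/consistentP => x y; rewrite !mem_cat => xs ys; apply/negP => /andP[/eqP e].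
have ax : a x.1 = x.2 by case/orP: xs => /good.
have ay : a y.1 = y.2 by case/orP: ys => /good.
by rewrite -ax -ay e eqxx.
Qed.

End Correctness.

(** * The reduction runs in polynomial time *)

Lemma sz_take X (cX : coded X) n (s : seq X) : sz (take n s) <= sz s.
Proof. by elim: s n => [|x s IH] [|n] //=; rewrite !sz_cons ?ltnS ?leq_add2l //; lia. Qed.

Lemma sz_behead X (cX : coded X) (s : seq X) : sz (behead s) <= sz s.
Proof. by case: s => // x s; rewrite sz_cons /=; lia. Qed.

Lemma sz_drop X (cX : coded X) n (s : seq X) : sz (drop n s) <= sz s.
Proof.
by elim: n s => [|n IH] [|x s] //=; apply: leq_trans (IH s) _; rewrite sz_cons; lia.
Qed.

Lemma pt_select X (cX : coded X) (c : X -> seq literal) (t : X -> nat) :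
  polytime c -> polytime t -> polytime (fun x => select (c x) (t x)).
Proof.
move=> Hc Ht.
apply: (pt_case (g := fun _ x _ => [:: x]) (h := fun=> [:: (0, true); (0, false)])).
- exact: pt_drop.
- by pt_auto.
- exact: pt_const.
Qed.

Lemma sz_select c t : sz (select c t) <= sz c + 20.
Proof.
rewrite /select; have := @sz_drop literal (coded_pair coded_nat coded_bool) t c.
case: (drop t c) => [|x s] //=.
  by move=> _; apply: leq_trans (leq_addl _ _).
by rewrite !sz_cons sz_nil => H; lia.
Qed.

Lemma pt_selected X (cX : coded X) (g : X -> seq (seq literal)) (w : X -> seq nat) :
  polytime g -> polytime w -> polytime (fun x => selected (g x) (w x)).
Proof.
move=> Hg Hw; rewrite /selected; apply: pt_snd.
apply: (pt_fold
  (f := fun _ st c => (behead st.1, select c (head 0 st.1) ++ st.2))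
  (a := fun x => (w x, [::])) (h := fun x => sz (w x) + 40 * sz (g x) + 40)) => //.
- apply: pt_pair; first by pt_auto.
  by apply: pt_cat; [apply: pt_select|]; pt_auto.
- by pt_auto.
- by apply: pb_add (pb_const _); apply: pb_add; [|apply: pb_mul (pb_const _) _]; apply: pt_size.
move=> x n _; move: (@sz_take (seq literal)
  (@coded_seq literal (coded_pair coded_nat coded_bool)) n (g x)); set s := take n _ => Hs.
set f := fun _ => _.
(* A clause adds its own size plus a constant; the list node that holds it, counted 40 times, pays
   for the constant. *)
have H st : sz (foldl f st s) <= sz st + 40 * sz s.
  elim: s st {Hs} => [|c s IH] [u v] /=; first by lia.
  apply: leq_trans (IH _) _; rewrite /f /= !sz_pair !sz_cons.
  have := @sz_cat literal (coded_pair coded_nat coded_bool) (select c (head 0 u)) v.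
  have := sz_select c (head 0 u).
  have := sz_behead coded_nat u; lia.
by apply: leq_trans (H _) _; rewrite sz_pair sz_nil; lia.
Qed.

Lemma pt_consistent : polytime consistent.
Proof.
apply: (pt_all (p := fun s x => all (fun y => ~~ conflict x y) s) (l := fun s => s)) pt_id.
apply: (pt_all (p := fun (z : seq literal * literal) y => ~~ conflict z.2 y) (l := fun z => z.1)).
  by rewrite /conflict; pt_auto.
by pt_auto.
Qed.

Lemma pt_compatible : polytime (fun z : (row * seq nat) * (row * seq nat) => compatible z.1 z.2).
Proof.
apply: pt_and; first by pt_auto.
by apply: (pt_comp pt_consistent); apply: pt_cat; apply: pt_selected; pt_auto.
Qed.

(** Each map binds one more variable, so the environment is a left-nested pair of all that has been
    bound so far. *)
Lemma pt_adjacency : polytime (fun z : seq row * seq (seq nat) => adjacency z.1 z.2).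
Proof.
apply: (pt_map (f := fun (z : seq row * seq (seq nat)) r =>
  [seq [seq [seq compatible (r, w) (r', w') | w' <- z.2] | r' <- z.1]
    | w <- z.2])); last by pt_auto.
apply: (pt_map (f := fun (z : (seq row * seq (seq nat)) * row) w =>
  [seq [seq compatible (z.2, w) (r', w') | w' <- z.1.2] | r' <- z.1.1])); last by pt_auto.
apply: (pt_map (f := fun (z : (seq row * seq (seq nat)) * row * seq nat) r' =>
  [seq compatible (z.1.2, z.2) (r', w') | w' <- z.1.1.2])); last by pt_auto.
apply: (pt_map (f := fun (z : (seq row * seq (seq nat)) * row * seq nat * row) w' =>
  compatible (z.1.1.2, z.1.2) (z.2, w'))); last by pt_auto.
apply: (pt_comp (f := fun z : (seq row * seq (seq nat)) * row * seq nat * row * seq nat =>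
  ((z.1.1.1.2, z.1.1.2), (z.1.2, z.2))) pt_compatible).
by pt_auto.
Qed.

Lemma pt_expand : polytime expand.
Proof.
apply: pt_cat; last apply: pt_cat;
  apply: (pt_map (f := fun _ w => _ :: w) (l := fun s => s)) => //; pt_auto.
Qed.

Lemma sz_words h : sz (words h) <= 3 ^ h * (h * 6).+2 + 1.
Proof.
rewrite -size_words; apply: sz_seq_le => w n nh.
move: (nth _ _ _) (mem_nth w nh) => v; rewrite mem_words => /andP[/eqP <- v3].
apply: leq_trans (@sz_seq_le nat _ v 5 _) _; last by rewrite addn1.
by move=> x i /(mem_nth x) /(allP v3) /=; rewrite sz_nat; lia.
Qed.

(** The word list is exponential in [h], but every [h] reached has [9 ^ h <= 9 * maxn m 1], so the
    accumulator stays polynomial in the number of clauses. *)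
Lemma pt_scale : polytime scale.
Proof.
have h_step : polytime (fun z : nat * (nat * (nat * seq (seq nat))) => scale_step z.1 z.2).
  apply: pt_if; [by pt_auto| |by pt_auto].
  apply: pt_pair; first by pt_auto.
  apply: pt_pair; first by pt_auto.
  by apply: (pt_comp pt_expand); pt_auto.
apply: (pt_fold (f := fun F st _ => scale_step (size F) st) (a := fun=> (1, (9, words 1)))
  (h := fun F => 10 * (9 * (size F + 1) + 1) * (9 * (size F + 1) + 1))).
- apply: (pt_comp (f := fun z => (size z.1, z.2.1)) h_step).
  by pt_auto.
- exact: pt_const.
- exact: pt_id.
- have Hs : polybounded (fun F : seq (seq literal) => 9 * (size F + 1) + 1).
    apply: pb_add (pb_const _); apply: pb_mul (pb_const _) _.
    apply: pb_add (pb_const _); apply: pb_le pb_sz _ => F.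
    by apply: ltnW; apply: size_sz.
  by apply: pb_mul => //; apply: pb_mul (pb_const _) _.
move=> F n nF; set f := fun _ => _.
have -> : foldl f (1, (9, words 1)) (take n F) = iter n (scale_step (size F)) (scaled 1).
  rewrite -[(1, (9, words 1))]/(scaled 1) -{2}(size_takel nF).
  elim: (take n F) (scaled 1) => //= c s IH st; by rewrite IH -iterSr.
have [h [-> h0 hm _]] := scale_iter (size F) n.
rewrite !sz_pair !sz_nat; have := sz_words h.
have h9 := ltn_expl h (isT : 1 < 9).
have h39 : 3 ^ h <= 9 ^ h by apply: leq_expl.
set M := 9 * (size F + 1); have hM : 9 ^ h <= M by apply: leq_trans hm _; rewrite /M; lia.
have : 3 ^ h * (h * 6).+2 <= M * (M * 6).+2 by apply: leq_mul; lia.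
by nia.
Qed.

Lemma sz_rcons X (cX : coded X) (s : seq X) x : sz (rcons s x) = (sz x + sz s).+1.
Proof. by elim: s => //= y s IH; rewrite !sz_cons IH; lia. Qed.

(** Tags and counter are unary and grow along the fold; the fixed bound [N] keeps the cost per
    clause constant in the induction. *)
Lemma sz_rows_state h N F : size F <= N ->
  let st := foldl (add_clause h) (0, [:: (0, [::])]) F in
  [/\ st.1 <= h, (head (0, [::]) st.2).1 <= size F &
      sz st <= sz F + size F * (2 * h + 2 * N + 30) + 20].
Proof.
elim/last_ind: F => [|F c IH]; first by split.
rewrite size_rcons => FN; have := IH (ltnW FN); rewrite foldl_rcons.
case: foldl => n [|[t g] rs] /= [nh tF].
  move=> H; split=> //.
  by apply: leq_trans H _; rewrite sz_rcons [(size F).+1 * _]mulSn; lia.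
rewrite !sz_rcons [(size F).+1 * _]mulSn !sz_pair !sz_cons !sz_pair !sz_nat => H.
rewrite /add_clause [(_, _).2]/= [(_, _).1]/=; case: eqP => n0 /=; split; try lia.
  by rewrite !sz_pair !sz_cons !sz_pair !sz_nat !sz_cons sz_nil; lia.
by rewrite !sz_pair !sz_cons !sz_pair !sz_nat !sz_cons; lia.
Qed.

Lemma pt_rows (X : Type) (cX : coded X) (h : X -> nat) (F : X -> seq (seq literal)) :
  polytime h -> polytime F -> polytime (fun x => rows (h x) (F x)).
Proof.
move=> Hh HF; apply: pt_snd.
apply: (pt_fold (f := fun x => add_clause (h x)) (a := fun=> (0, [:: (0, [::])]))
  (h := fun x => sz (F x) * (sz (h x) + 2 * sz (F x) + 40) + 40)) => //.
- have H : polytime (fun z : nat * ((nat * seq row) * seq literal) => add_clause z.1 z.2.1 z.2.2).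
    apply: (pt_case (g := fun z r rs =>
      if z.2.1.1 == 0 then (z.1.-1, (r.1.+1, [:: z.2.2]) :: z.2.1.2)
      else (z.2.1.1.-1, (r.1, z.2.2 :: r.2) :: rs)) (h := fun z => z.2.1)).
    + by pt_auto.
    + by apply: pt_if; pt_auto.
    + by pt_auto.
  apply: (pt_comp (f := fun z => (h z.1, (z.2.1, z.2.2))) H).
  apply: pt_pair; last by pt_auto.
  exact: (pt_comp Hh (pt_fst pt_id)).
- exact: pt_const.
- apply: pb_add (pb_const _); apply: pb_mul; first exact: pt_size.
  apply: pb_add (pb_const _); apply: pb_add; first exact: pt_size.
  by apply: pb_mul (pb_const _) _; apply: pt_size.
move=> x n nF; have [|_ _] := @sz_rows_state (h x) (sz (F x)) (take n (F x)).
  by rewrite size_takel //; apply: leq_trans nF (ltnW (size_sz _ _)).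
move/leq_trans; apply.
have H1 := @sz_take (seq literal) (@coded_seq literal (coded_pair coded_nat coded_bool)) n (F x).
have H2 := @size_sz (seq literal) (@coded_seq literal (coded_pair coded_nat coded_bool)) (F x).
rewrite sz_nat size_takel //; move: (sz (F x)) (sz (take n (F x))) (size (F x)) nF H1 H2.
move=> a b m nm ba ma.
have : n * (2 * h x + 2 * a + 30) <= a * (2 * h x + 2 * a + 30) by rewrite leq_mul2r; lia.
by nia.
Qed.

(** * The decision procedure *)

Fixpoint clear d n : cmd :=
  if n is n'.+1 then CSeq (CAssign d ELeaf) (clear d.+1 n') else CAssign d ELeaf.

Lemma runs_clear d n S : runs (clear d n) S (2 * n + 1)
  (fun S' => forall j, S' j = if d <= j <= d + n then Leaf else S j).
Proof.
elim: n d S => [|n IH] d S /=.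
  apply: runs_assign => j; rewrite /upd /= addn0 -eqn_leq eq_sym.
  by [].
apply: (runs_leT (T := (1 + (2 * n + 1)).+1));
  last by lia.
apply: runs_seq; apply: runs_assign; apply: runs_le (IH _ _) (leqnn _) _ => S' H j.
rewrite H /upd /=; case: (eqVneq j d) => [->|jd]; first by rewrite ltnn leqnn leq_addr.
by rewrite addSnnS [in RHS]leq_eqVlt eq_sym (negbTE jd).
Qed.

Lemma deterministic_clear d n : deterministic (clear d n).
Proof. by elim: n d => //= n IH d. Qed.

(** Unlike the programs of [computes], a decider may rely on its other variables
    being initially empty. *)
Lemma runs_decider p (A : problem) T d S (x : A) :
  decides p A T -> S d = encode x ->
  runs (CSeq (clear d.+1 (cmd_vars p)) (cmd_shift d p)) S
    (2 * cmd_vars p + T (param x) + 2)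
    (fun S' => (nonleaf (S' d) <-> yes x) /\ forall j, j < d -> S' j = S j).
Proof.
move=> [Dp H] Sd; have [Hh Hy] := H x.
have [t tT [s' X _]] := halted_exec Dp Hh.
move: Hy; rewrite /run (exec_iter_halted _ X tT) => Hy.
apply: (runs_leT (T := ((2 * cmd_vars p + 1) + T (param x)).+1));
  last by lia.
apply: runs_seq; apply: runs_le (runs_clear _ _ _) (leqnn _) _ => S1 S1E.
have [|S2 X2 [A2 F2]] := @exec_shift (cmd_vars p).+1 d _ _ _ _ S1 X (ltnW (ltnSn _)).
  move=> i iN; rewrite S1E /upd; case: i iN => [|i] iN.
    by rewrite addn0 ltnn Sd.
  by rewrite addSn addnS /=; case: ifP => //; lia.
exists S2, t; split=> //; split; first by rewrite -(addn0 d) A2.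
by move=> j jd; rewrite F2 // S1E; case: ifP => //; lia.
Qed.

Section Search.
Variables (p : cmd) (T : nat -> nat).
Hypothesis pP : decides p permutation_clique T.
Variables (ca : cmd) (ta : seq row * seq (seq nat) -> nat).
Hypothesis caP : computes _ _ ca (fun z : seq row * seq (seq nat) => adjacency z.1 z.2) ta.

(** Variable 3 holds an item [(c, (0, acc))], whose [acc] is a complete list of columns. The final
    [CAssign 3 ELeaf] acts as a skip. *)
Definition search_test : cmd :=
  CSeq (CAssign 3 (ENode (EVar 0) (ERight (ERight (EVar 3)))))
  (CSeq (cmd_shift 3 ca)
  (CSeq (CSeq (clear 4 (cmd_vars p)) (cmd_shift 3 p))
  (CIf (EVar 3) (CAssign 2 (ENode ELeaf ELeaf)) (CAssign 3 ELeaf)))).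

(** The two recursive calls of [multisets] become two stack items; the right child of a unary number
    is its predecessor. *)
Definition search_push : cmd :=
  CAssign 1 (ENode (ENode (ELeft (EVar 3)) (ENode (ERight (ELeft (ERight (EVar 3))))
      (ENode (ELeft (ELeft (EVar 3))) (ERight (ERight (EVar 3))))))
    (ENode (ENode (ERight (ELeft (EVar 3))) (ERight (EVar 3))) (EVar 1))).

(** Variable 0 holds the rows, variable 1 a stack of arguments of [multisets]
    still to be expanded, and variable 2 whether a clique has been found. *)
Definition search_loop : cmd :=
  CWhile (EVar 1)
    (CSeq (CAssign 3 (ELeft (EVar 1)))
    (CSeq (CAssign 1 (ERight (EVar 1)))
    (CIf (ELeft (ERight (EVar 3)))
      (CIf (ELeft (EVar 3)) search_push (CAssign 3 ELeaf))
      search_test))).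

Variables (rs : seq row) (L : seq (seq nat)) (B : nat).
Let k := size rs.
Hypothesis taB : forall cs, size cs = k -> {subset cs <= L} -> ta (rs, cs) <= B.

(** A classical truth value that serves only to specify variable 2; the program gets it from [p]. *)
Definition cliqueb cs := `[< has_permutation_clique (graph rs cs) >].

Let C := B + T k + 2 * cmd_vars p + 20.

Let item := (seq (seq nat) * (nat * seq (seq nat)))%type.

Let state S (stk : seq item) b :=
  [/\ S 0 = code rs, S 1 = code stk & S 2 = enc_bool b].

(** One case of [multisets]: letters exhausted, places left. Here and in the next two lemmas the
    rest of the loop is a continuation with bound [T'], so the stack below the item stays
    arbitrary. *)
Lemma runs_search_drop n acc stk b S T' Q :
  state S (([::], (n.+1, acc)) :: stk) b ->
  (forall S', state S' stk b -> runs search_loop S' T' Q) ->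
  runs search_loop S (C + T') Q.
Proof.
case=> S0 S1 S2 K.
apply: (runs_leT (T := ((1 + (1 + 1.+2).+1).+1 + T').+1));
  last by rewrite /C; lia.
apply: runs_whileT; first by rewrite /= S1.
apply: runs_seq; apply: runs_assign; apply: runs_seq; apply: runs_assign.
rewrite /upd /= S1; apply: runs_if => /=; apply: runs_if => /=; apply: runs_assign.
by apply: K; rewrite /upd /=.
Qed.

Lemma runs_search_push x c n acc stk b S T' Q :
  state S ((x :: c, (n.+1, acc)) :: stk) b ->
  (forall S', state S' ((x :: c, (n, x :: acc)) :: (c, (n.+1, acc)) :: stk) b ->
     runs search_loop S' T' Q) ->
  runs search_loop S (C + T') Q.
Proof.
case=> S0 S1 S2 K.
apply: (runs_leT (T := ((1 + (1 + 1.+2).+1).+1 + T').+1));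
  last by rewrite /C; lia.
apply: runs_whileT; first by rewrite /= S1.
apply: runs_seq; apply: runs_assign; apply: runs_seq; apply: runs_assign.
rewrite /upd /= S1; apply: runs_if => /=; apply: runs_if => /=; apply: runs_assign.
by apply: K; rewrite /upd /=.
Qed.

Lemma runs_search_leaf c acc stk b S T' Q :
  size acc = k -> {subset acc <= L} ->
  state S ((c, (0, acc)) :: stk) b ->
  (forall S', state S' stk (b || cliqueb acc) -> runs search_loop S' T' Q) ->
  runs search_loop S (C + T') Q.
Proof.
move=> ak aL [S0 S1 S2] K.
apply: (runs_leT (T := ((1 + (1 + (1 +
  (B + ((2 * cmd_vars p + T k + 2) + 1.+1).+1).+1).+1.+1).+1).+1 + T').+1));
  last by rewrite /C; lia.
apply: runs_whileT; first by rewrite /= S1.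
apply: runs_seq; apply: runs_assign; apply: runs_seq; apply: runs_assign.
rewrite /upd /= S1; apply: runs_if => /=; apply: runs_seq; apply: runs_assign.
apply: runs_seq; apply: (runs_le (runs_call (x := (rs, acc)) (d := 3) caP _) (taB ak aL)).
  by rewrite /upd /= S0.
move=> S3 [E3 F3]; apply: runs_seq.
pose G : permutation_clique := Tagged (fun k => sgraph ('I_k * 'I_k)%type) (graph rs acc).
apply: (runs_le (@runs_decider p _ T 3 S3 G pP _) (leqnn _)).
  by rewrite E3 /= enc_graph.
move=> S4 [E4 F4]; apply: runs_if.
have F j : j < 3 -> S4 j = if j == 1 then code stk else S j.
  by case: j => [|[|[|]]] // _; rewrite F4 // F3.
rewrite [eval _ _]/=; have -> : nonleaf (S4 3) = cliqueb acc.
  by apply/idP/asboolP => /E4.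
case Eb : (cliqueb acc); apply: runs_assign; apply: K; rewrite /upd Eb;
  by split; rewrite /= ?F //= ?orbT ?orbF.
Qed.

(** A push lowers [size c + n] by one in both new items, so the passes are at most the nodes of a
    complete binary tree of that depth, [2 ^ (size c + n).+1 - 1] in number. *)
Lemma runs_search c n acc stk b S T' Q :
  n + size acc = k -> {subset c <= L} -> {subset acc <= L} ->
  state S ((c, (n, acc)) :: stk) b ->
  (forall S', state S' stk (b || has cliqueb (multisets c n acc)) ->
     runs search_loop S' T' Q) ->
  runs search_loop S ((2 ^ (size c + n).+1).-1 * C + T') Q.
Proof.
have weaken N T1 S1 Q1 : 0 < N -> runs search_loop S1 (C + T1) Q1 ->
    runs search_loop S1 (N * C + T1) Q1.
  move=> N0 /runs_le; apply=> //.
  by rewrite leq_add2r -{1}[C]mul1n leq_mul2r N0 orbT.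
have pos m : 0 < (2 ^ m.+1).-1 by rewrite expnS; have := expn_gt0 2 m; lia.
elim: c n acc stk b S T' => [|x c IHc].
  case=> [|n] acc stk b S T' nk _ aL St K; apply: weaken => //.
    by apply: runs_search_leaf St _ => // S' St'; apply: K; rewrite /= orbF.
  by apply: runs_search_drop St _ => // S' St'; apply: K; rewrite /= orbF.
elim=> [|n IHn] acc stk b S T' nk cL aL St K.
  by apply: weaken => //; apply: runs_search_leaf St _ => // S' St'; apply: K; rewrite /= orbF.
set N1 := (2 ^ (size (x :: c) + n).+1).-1.
have -> : (2 ^ (size (x :: c) + n.+1).+1).-1 * C + T' = C + (N1 * C + (N1 * C + T')).
  have -> : (2 ^ (size (x :: c) + n.+1).+1).-1 = 1 + N1 + N1.
    by rewrite /N1 addnS expnS; have := expn_gt0 2 (size (x :: c) + n).+1; lia.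
  by rewrite !mulnDl; lia.
apply: runs_search_push St _ => S' St'; apply: IHn St' _ => //.
- by rewrite /= addnS.
- by move=> y; rewrite inE => /predU1P[->|/aL //]; apply: cL; rewrite mem_head.
move=> S2 St2; rewrite /N1 /= addSnnS; apply: IHc St2 _ => //.
  by move=> y yc; apply: cL; rewrite inE yc orbT.
by move=> S3 St3; apply: K; rewrite /= has_cat orbA.
Qed.
End Search.

(** * The complete solver and its running time *)

Definition prepare (F : seq (seq literal)) :
    seq row * seq (seq (seq nat) * (nat * seq (seq nat))) :=
  (rows (scale F).1 F,
   [:: ((scale F).2.2, (size (rows (scale F).1 F), [::]))]).

Lemma pt_prepare : polytime prepare.
Proof.
have Hs : polytime (fun F => (scale F).1) by apply: pt_fst; apply: pt_scale.
have Hr : polytime (fun F => rows (scale F).1 F) by apply: pt_rows => //; apply: pt_id.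
apply: pt_pair => //; apply: pt_cons; last exact: pt_const.
apply: pt_pair; first by do 2 apply: pt_snd; apply: pt_scale.
by apply: pt_pair; [apply: pt_length|exact: pt_const].
Qed.

(** The scale as a function of [m] alone, because the running time must depend on the parameter
    only. *)
Definition height m := (iter m (scale_step m) (scaled 1)).1.

(** The quotient is [m / h] rounded up; the successor counts the empty row 0. *)
Definition nrows m := ((m + height m).-1 %/ height m).+1.

Lemma height_spec m :
  [/\ 0 < height m, 9 ^ height m <= 9 * maxn m 1 & m < 9 ^ height m].
Proof.
rewrite /height; have [h [-> h0 hm]] := scale_iter m m.
by rewrite orbb => H; split.
Qed.

Lemma scaleE F : scale F = scaled (height (size F)).
Proof.
have [h [E _ _ _]] := scale_iter (size F) (size F).
rewrite /height E /= -E /scale -[(1, (9, words 1))]/(scaled 1).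
by elim: {2 3}F (scaled 1) => //= c s IH st; rewrite IH -iterSr.
Qed.

Lemma size_rows F : size (rows (height (size F)) F) = nrows (size F).
Proof.
have [h0 _ _] := height_spec (size F); set h := height _ in h0 *.
have := rows_invariant F h0; rewrite /rows /nrows -/h.
case: foldl => n [|r rs] /= [_ _ _ [H nh] [H1 _]] //; congr _.+1.
have -> : (size F + h).-1 = size rs * h + (h.-1 - n) by lia.
by rewrite divnMDl // divn_small ?addn0; lia.
Qed.

(** Three literals per clause, with unary variables below [3 * m], give size [O(m ^ 2)]. As
    [m + 2 >= 2], six more factors absorb the constant as [2 ^ 6]. *)
Lemma sz_cnf3 (F : cnf3) : (sz (clauses F)).+2 <= (size (clauses F) + 2) ^ 8.
Proof.
set m := size _; have Hl (l : literal) : l.1 < 3 * m -> sz l <= 6 * m + 4.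
  by case: l => v b /= vm; rewrite sz_pair sz_nat; have := sz_bool b; lia.
have : sz (clauses F) <= m * (18 * m + 20) + 1.
  apply: leq_trans (sz_seq_le (B := 18 * m + 16) _) _; last by rewrite -/m; nia.
  move=> c0 n nm; have := mem_nth c0 nm; set c := nth _ _ _ => cF.
  have c3 : size c <= 3 := allP (cnf3_width F) c cF.
  have cv := allP (allP (cnf3_vars F) c cF).
  apply: leq_trans (sz_seq_le (B := 6 * m + 4) _) _; last first.
    by apply: leq_trans (leq_add (leq_mul c3 (leqnn _)) (leqnn 1)) _; lia.
  by move=> l0 i ic; apply: Hl; apply: cv; apply: mem_nth.
have : 2 ^ 6 * (m + 2) ^ 2 <= (m + 2) ^ 8.
  by rewrite (expnD _ 6 2) leq_mul2r; apply/orP; right; apply: leq_expl; lia.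
rewrite (_ : 2 ^ 6 = 64) // -mulnn; nia.
Qed.

Lemma solver_correct p T : decides p permutation_clique T ->
  exists c d, deterministic c /\ forall F : cnf3, let m := size (clauses F) in
    runs c (upd (fun=> Leaf) 0 (code (clauses F)))
      ((m + 2) ^ d * (2 ^ (3 ^ height m + nrows m + 1) * (T (nrows m)).+1))
      (fun s => nonleaf (s 0) <-> satisfiable F).
Proof.
move=> pP.
have [[cp [tp [cpP tpB]]] szp] := pt_prepare.
have [[ca [ta [caP [da taB]]]] _] := pt_adjacency.
set P1 := fun F => _ in szp.
(* One exponent for all polynomial costs. A column list has at most [P1 F] words of size at most
   [P1 F] each, hence the product. *)
have [d Hd] : polybounded (fun F =>
    tp F + ((P1 F + (P1 F * (P1 F + 1) + 1) + 3) ^ da) + (2 * cmd_vars p + 40)).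
  apply: pb_add (pb_const _); apply: pb_add => //; apply: pb_exp.
  apply: pb_add (pb_const _); apply: pb_add => //; apply: pb_add (pb_const _).
  by apply: pb_mul => //; apply: pb_add (pb_const _).
exists (CSeq cp (CSeq (CAssign 1 (ERight (EVar 0))) (CSeq (CAssign 0 (ELeft (EVar 0)))
  (CSeq (CAssign 2 ELeaf) (CSeq (search_loop p ca) (CAssign 0 (EVar 2))))))), (8 * d).
split.
  rewrite /= !deterministic_shift deterministic_clear.
  by rewrite (proj1 cpP) (proj1 caP) (proj1 pP).
move=> F m; pose h := height m; pose rs := rows h (clauses F); pose k := nrows m.
have rsk : size rs = k by apply: size_rows.
have prepE : prepare (clauses F) = (rs, [:: (words h, (k, [::]))]).
  by rewrite /prepare scaleE /= -/m -/h -/rs rsk.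
have P1E : P1 (clauses F) = sz (rs, [:: (words h, (k, [::] : seq (seq nat)))]) by rewrite /P1 prepE.
have taB' cs : size cs = size rs -> {subset cs <= words h} ->
    ta (rs, cs) <= (P1 (clauses F) + (P1 (clauses F) * (P1 (clauses F) + 1) + 1) + 3) ^ da.
  move=> csk csL; apply: leq_trans (taB _) _; apply: leq_expl.
  have : sz cs <= size cs * (P1 (clauses F)).+1 + 1.
    apply: sz_seq_le => w n nh; have /csL/(sz_mem (coded_seq coded_nat)) := mem_nth w nh.
    move/leq_trans; apply; rewrite P1E sz_pair sz_cons sz_pair.
    apply: leqW; apply: leq_trans (leq_addl _ _); apply: leqW.
    by apply: leq_trans (leq_addr _ _); apply/leqW/leq_addr.
  have : size cs <= P1 (clauses F).
    rewrite csk; apply: ltnW; apply: leq_trans (size_sz _ rs) _.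
    by rewrite P1E sz_pair; apply: leqW; apply: leq_addr.
  have : sz rs <= P1 (clauses F) by rewrite P1E sz_pair; apply: leqW; apply: leq_addr.
  rewrite sz_pair; move: (P1 _) (sz rs) (sz cs) (size cs) => u v w n vu nu.
  have : n * u.+1 <= u * u.+1 by rewrite leq_mul2r nu orbT.
  by lia.
pose B := (P1 (clauses F) + (P1 (clauses F) * (P1 (clauses F) + 1) + 1) + 3) ^ da.
pose N := 2 ^ (size (words h) + k).+1.
apply: (runs_leT (T := (tp (clauses F) + (1 + (1 + (1 +
  ((N.-1 * (B + T (size rs) + 2 * cmd_vars p + 20) + 1) + 1).+1).+1).+1).+1).+1)).
  apply: runs_seq; apply: runs_le (proj2 cpP (clauses F) _ _) (leqnn _) _; first by [].
  move=> s1 E1; rewrite prepE in E1.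
  apply: runs_seq; apply: runs_assign; apply: runs_seq; apply: runs_assign.
  apply: runs_seq; apply: runs_assign; apply: runs_seq.
  apply: (runs_search pP caP taB' (c := words h) (n := k)
    (acc := [::]) (stk := [::]) (b := false)) => //.
    by rewrite addn0.
    by split; rewrite /upd /= ?E1.
  move=> S' [S0 S1 S2]; apply: runs_whileF; first by rewrite /= S1.
  apply: runs_assign; rewrite /upd /= S2 /= .
  have -> (b : bool) : nonleaf (enc_bool b) = b by case: b.
  have [h0 _ _] := height_spec m.
  rewrite -rsk; split.
    by case/hasP => cs _ /asboolP; apply: clique_sat h0 _.
  case=> a sat; have [cs csm C] := sat_clique h0 (cnf3_width F) sat.
  by apply/hasP; exists cs => //; apply/asboolP.
have NE : N = 2 ^ (3 ^ h + k + 1) by rewrite /N size_words addn1.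
have N0 : 0 < N by rewrite /N expn_gt0.
have G : tp (clauses F) + B + (2 * cmd_vars p + 40) <= (m + 2) ^ (8 * d).
  apply: leq_trans (Hd _) _; rewrite expnM; apply: leq_expl; exact: sz_cnf3.
rewrite -/h -/k -NE rsk; move: G; set G := (m + 2) ^ _; move: G => G HG.
(* The sum of the costs is bounded by a product because [N] and [(T k).+1] are positive. *)
apply: leq_trans (leq_mul HG (leqnn _)).
move: (tp _) B (T k) N N0 {HG NE} => t B0 Tk [//|n] _ /=.
nia.
Qed.

(** * Asymptotics *)

Lemma nrows_height m : nrows m * height m <= m + 2 * height m.
Proof.
have [h0 _ _] := height_spec m.
have := leq_divM (m + height m).-1 (height m); rewrite /nrows mulSn; lia.
Qed.

Lemma leq_nrows_height m : m <= nrows m * height m.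
Proof.
have [h0 _ _] := height_spec m; have := ltn_ceil (m + height m).-1 h0.
by rewrite /nrows; lia.
Qed.

(** The additional factor 3 absorbs the [+ 2], so that [ln (m + 2)] is at most a constant times
    [height m]. *)
Lemma add2_leq_27_height m : m + 2 <= 27 ^ height m.
Proof.
have [h0 _ H] := height_spec m; rewrite (_ : 27 = 9 * 3) // expnMn.
have : 3 <= 3 ^ height m by case: (height m) h0 => // h _; rewrite expnS leq_pmulr ?expn_gt0.
by move: (9 ^ _) (3 ^ _) H => a b; nia.
Qed.

Lemma nrows_le m : nrows m <= m + 2.
Proof. by have := nrows_height m; have [h0 _ _] := height_spec m; nia. Qed.

Lemma sqr_3_height m : 0 < m -> 3 ^ height m * 3 ^ height m <= 9 * m.
Proof.
move=> m0; have [_ H _] := height_spec m.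
by rewrite -expnMn (leq_trans H) //; lia.
Qed.

Local Open Scope ring_scope.

Section Asymptotics.
Variable R : realType.

(** One-sided [o(m)]: without absolute values, sums and comparisons need no sign conditions.
    Nonnegativity is restored in [log_time_littleo]. *)
Definition small (g : nat -> R) :=
  forall e : R, 0 < e -> exists M, forall m, (M <= m)%N -> g m <= e * m%:R.

Lemma small_le g g' : small g' -> (forall m, (0 < m)%N -> g m <= g' m) -> small g.
Proof.
move=> H gg e /H[M HM]; exists M.+1 => m Mm.
by apply: le_trans (gg m _) (HM m _); [apply: leq_trans Mm | apply: ltnW].
Qed.

Lemma small_add g g' : small g -> small g' -> small (fun m => g m + g' m).
Proof.
move=> H H' e e0; have [M HM] := H (e / 2) (divr_gt0 e0 (ltr0n _ 2)).
have [M' HM'] := H' (e / 2) (divr_gt0 e0 (ltr0n _ 2)).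
exists (maxn M M') => m; rewrite geq_max => /andP[/HM a /HM' b].
by apply: le_trans (lerD a b) _; rewrite -mulrDl -splitr.
Qed.

Lemma small_scale c g : 0 < c -> small g -> small (fun m => c * g m).
Proof.
move=> c0 H e e0; have [M HM] := H (e / c) (divr_gt0 e0 c0).
exists M => m /HM; rewrite -(ler_pM2l c0) => /le_trans; apply.
by rewrite mulrA mulrCA divff ?mulr1 // gt_eqF.
Qed.

Lemma natr_above (x : R) : exists n : nat, x <= n%:R.
Proof.
exists (Num.bound `|x|); apply: le_trans (ler_norm _) _.
by apply/ltW/archi_boundP/normr_ge0.
Qed.

Lemma small_const c : small (fun=> c).
Proof.
move=> e e0; have [n nP] := natr_above (c / e); exists n => m nm.
by rewrite mulrC -ler_pdivrMr // (le_trans nP) // ler_nat.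
Qed.

Lemma small_3_height : small (fun m => (3 ^ height m)%:R).
Proof.
move=> e e0; have [n nP] := natr_above (9 / (e * e)); exists n.+1 => m nm.
have m0 : (0 < m)%N by apply: leq_trans nm.
have em0 : 0 <= e * m%:R by rewrite mulr_ge0 // ltW.
(* Squares are compared: [9 * m <= (e * m) ^ 2] as soon as [m >= 9 / e ^ 2]. *)
rewrite -ler_sqr ?nnegrE // !expr2 -natrM.
apply: (@le_trans _ _ (9 * m)%:R); first by rewrite ler_nat sqr_3_height.
rewrite mulrACA natrM [leRHS]mulrA ler_wpM2r // mulrC -ler_pdivrMr ?mulr_gt0 //.
by rewrite (le_trans nP) // ler_nat ltnW.
Qed.

Lemma height_unbounded n : exists M, forall m, (M <= m)%N -> (n <= height m)%N.
Proof.
exists (9 ^ n)%N => m nm; have [_ _ H] := height_spec m.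
by have := leq_ltn_trans nm H; rewrite ltn_exp2l // => /ltnW.
Qed.

Lemma small_nrows : small (fun m => (nrows m)%:R).
Proof.
apply: (small_le (g' := fun m => m%:R / (height m)%:R + 2)) => [|m m0]; last first.
  have [h0 _ _] := height_spec m.
  rewrite -(ler_pM2r (x := (height m)%:R)) ?ltr0n // mulrDl divfK ?pnatr_eq0 -?lt0n //.
  by rewrite -!natrM -natrD ler_nat nrows_height.
apply: small_add (small_const _) => e e0; have [n nP] := natr_above e^-1.
have [M HM] := height_unbounded n.+1; exists M => m /HM nh.
rewrite mulrC ler_wpM2r // -[leRHS]invrK lef_pV2 ?posrE ?invr_gt0 ?ltr0n //.
  by rewrite (le_trans nP) // ler_nat ltnW.
by apply: leq_trans nh.
Qed.

Lemma nrows_unbounded n : exists M, forall m, (M <= m)%N -> (n <= nrows m)%N.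
Proof.
(* With this [e], [(n + 1) * 3 ^ h <= m <= k * h], and [h < 3 ^ h] then gives [n * h <= k * h]. *)
have [|M HM] := small_3_height (e := n.+1%:R^-1); first by rewrite invr_gt0 ltr0n.
exists M.+1 => m Mm; have := HM m (ltnW Mm).
rewrite mulrC ler_pdivlMr ?ltr0n // -natrM ler_nat => H.
have := leq_nrows_height m; have : (height m < 3 ^ height m)%N by apply: ltn_expl.
have [h0 _ _] := height_spec m; move: H; move: (3 ^ _)%N => a.
move: (height m) h0 => b h0 H ab kb.
have : (b * n <= nrows m * b)%N by nia.
by rewrite mulnC leq_pmul2r.
Qed.

Lemma ln_add2 m : ln (m + 2)%:R <= ln 27 * (height m)%:R :> R.
Proof.
rewrite mulrC mulr_natl -lnXn ?ltr0n // -natrX ler_ln ?posrE ?ltr0n ?expn_gt0 ?addn2 //.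
by rewrite ler_nat -addn2 add2_leq_27_height.
Qed.

Lemma ln27_gt0 : 0 < ln 27 :> R.
Proof. by rewrite ln_gt0 // ltr1n. Qed.

(** This is the gain from grouping: [ln k <= ln 27 * h], so [k * ln k] is of order [k * h], that is
    [m]. From [h < 3 ^ h] and [9 ^ h <= 9 * m] one gets [m + 2 * h <= 20 * m]. *)
Lemma nrows_ln m : (0 < m)%N ->
  (nrows m)%:R * ln (nrows m)%:R <= (20 * ln 27) * m%:R :> R.
Proof.
move=> m0; have k0 : (0 < nrows m)%N by [].
have lnk : ln (nrows m)%:R <= ln 27 * (height m)%:R :> R.
  apply: le_trans (ln_add2 m); rewrite ler_ln ?posrE ?ltr0n ?addn2 // ler_nat -addn2.
  exact: nrows_le.
apply: le_trans (ler_wpM2l _ lnk) _; first by [].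
rewrite mulrCA -natrM [20 * _]mulrC -mulrA ler_pM2l ?ln27_gt0 // -natrM ler_nat.
apply: leq_trans (nrows_height m) _.
have : (height m < 3 ^ height m)%N by apply: ltn_expl.
have := sqr_3_height m0; move: (3 ^ _)%N => a; move: (height m) => b; nia.
Qed.

Lemma small_littleo (f : nat -> R) :
  (f =o_\oo (fun k => k%:R * ln (k%:R : R)))%classic ->
  small (fun m => `|f (nrows m)|).
Proof.
move=> fo e e0.
have /eqoP/(_ (e / (20 * ln 27))) := fo.
have C0 : 0 < 20 * ln 27 :> R by rewrite mulr_gt0 // ln27_gt0.
move=> /(_ (divr_gt0 e0 C0))[N _ HN].
have [M HM] := nrows_unbounded N; exists M.+1 => m Mm.
have m0 : (0 < m)%N by apply: leq_trans Mm.
have := HN (nrows m) (HM m (ltnW Mm)) => /= /le_trans; apply.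
rewrite ger0_norm; last by rewrite mulr_ge0 // ln_ge0 // ler1n.
rewrite mulrAC ler_pdivrMr // -mulrA ler_pM2l // [leRHS]mulrC.
exact: nrows_ln.
Qed.

(** Base-2 logarithm of a bound on the solver's time. The [2] collects the [+ 1] in the search
    exponent and the factor in [(T k).+1 <= 2 * 2 ^ |f k|], where the absolute value covers negative
    [f k]. *)
Definition log_time d (f : nat -> R) m : R :=
  d%:R * (ln (m + 2)%:R / ln 2) + ((3 ^ height m)%:R + ((nrows m)%:R + 2)) + `|f (nrows m)|.

Lemma ln2_gt0 : 0 < ln 2 :> R.
Proof. by rewrite ln_gt0 // ltr1n. Qed.

Lemma log_time_littleo d (f : nat -> R) :
  (f =o_\oo (fun k => k%:R * ln (k%:R : R)))%classic ->
  (log_time d f =o_\oo (fun m => m%:R : R))%classic.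
Proof.
move=> /small_littleo fs; have S : small (log_time d f).
  apply: small_add fs; apply: small_add; last first.
    apply: small_add small_3_height _; apply: small_add small_nrows _; exact: small_const.
  (* The logarithmic term is dominated by [3 ^ h], through [ln (m + 2) <= ln 27 * h]; [d.+1] keeps
     the factor positive when [d = 0]. *)
  apply: (small_le (g' := fun m => (d.+1%:R * (ln 27 / ln 2)) * (3 ^ height m)%:R)); last first.
    move=> m _; rewrite -mulrA; apply: ler_pM => //.
    - by rewrite divr_ge0 ?ltW ?ln2_gt0 // ln_gt0 // ltr1n addn2.
    - by rewrite ler_nat.
    rewrite mulrAC ler_pM2r ?invr_gt0 ?ln2_gt0 // (le_trans (ln_add2 m)) //.
    by rewrite ler_pM2l ?ln27_gt0 // ler_nat ltnW // ltn_expl.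
  apply: small_scale small_3_height.
  by rewrite mulr_gt0 ?ltr0n // divr_gt0 ?ln2_gt0 ?ln27_gt0.
apply/eqoP => e /S[M HM]; exists M => // m /= /HM H.
rewrite ger0_norm ?normr_nat //; rewrite addr_ge0 // addr_ge0 ?addr_ge0 //.
by rewrite mulr_ge0 // divr_ge0 ?ltW ?ln2_gt0 // ln_gt0 // ltr1n addn2.
Qed.

Lemma log_time_bound d (f : nat -> R) (T : nat -> nat) m :
  (forall n, (T n)%:R <= 2 `^ f n) ->
  ((m + 2) ^ d * (2 ^ (3 ^ height m + nrows m + 1) * (T (nrows m)).+1))%:R
    <= 2 `^ log_time d f m.
Proof.
move=> HT; have two0 : 2 != 0 :> R by rewrite pnatr_eq0.
have pD x y : 2 `^ (x + y) = 2 `^ x * 2 `^ y :> R.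
  by rewrite powRD // two0 implybT.
have HX : ((m + 2) ^ d)%:R = 2 `^ (d%:R * (ln (m + 2)%:R / ln 2)) :> R.
  rewrite /powR (negbTE two0) mulrA divfK ?gt_eqF ?ln2_gt0 //.
  by rewrite mulr_natl -lnXn ?ltr0n ?addn2 // lnK ?natrX // posrE exprn_gt0 // ltr0n.
have HT1 : (T (nrows m)).+1%:R <= 2 * 2 `^ `|f (nrows m)| :> R.
  rewrite -natr1 [leRHS]mulr_natl mulr2n lerD //.
    by apply: le_trans (HT _) _; rewrite ler_powR ?ler1n // ler_norm.
  by rewrite -[leLHS](powRr0 2) ler_powR ?ler1n.
have HP : (2 ^ (3 ^ height m + nrows m + 1))%:R * 2 =
    2 `^ ((3 ^ height m)%:R + ((nrows m)%:R + 2)) :> R.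
  by rewrite natrX -exprSr -powR_mulrn // addrA -!natrD addn1 addn2.
by rewrite /log_time pD pD -HX -HP -mulrA natrM ler_wpM2l // natrM -mulrA ler_wpM2l.
Qed.

End Asymptotics.

Lemma coin_prob_true n (E : pred (n.-tuple bool)) :
  (forall r, E r) -> coin_prob E = 1.
Proof.
move=> H; rewrite /coin_prob (_ : [set r | E r]%SET = [set: _]) ?cardsT.
  by rewrite divff // pnatr_eq0 card_tuple card_bool expn_eq0.
by apply/setP => r; rewrite !inE H.
Qed.

Theorem theorem5 (R : realType) :
  has_algorithm permutation_clique (fun k => k%:R * ln (k%:R : R)) ->
  has_randomized_algorithm three_sat (fun m => m%:R : R).
Proof.
case=> p [T [[f [fo HT]] pP]].
have [c [d [Dc H]]] := solver_correct pP.
exists c, (fun m => (m + 2) ^ d * (2 ^ (3 ^ height m + nrows m + 1) * (T (nrows m)).+1))%N.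
split.
  exists (log_time d f); split; first exact: log_time_littleo.
  by move=> m; apply: log_time_bound.
move=> F /=; have [s [t [X tT q]]] := H F.
set n := (_ * _)%N in tT *.
(* The final store is the same for every coin sequence, so each answer has probability 0 or 1. *)
have E r : run c (enc_seq (enc_seq enc_literal) (clauses F)) r n = Config [::] s r.
  exact: exec_iter_halted X tT.
split=> [r|y|y].
- by rewrite E.
- by rewrite coin_prob_true => [|r]; [rewrite ler_pdivrMr // mul1r ler_nat | rewrite E; apply/q].
- rewrite coin_prob_true => [|r]; first by rewrite ler_pdivrMr // mul1r ler_nat.
  by rewrite E; apply/negP => /q.
Qed.
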